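(* Let $\mathcal P=\{P_\theta:\theta\in\Theta\}$, $\Theta\subset\mathbb R^k$ open, be a parametric model on $(\mathcal X,\mathcal A)$, let $X_1,X_2,\dots$ be i.i.d. with distribution in $\mathcal P$, and fix $\theta_0\in\Theta$. Let $\kappa:\Theta\to\mathbb R^m$ be continuously differentiable in a neighborhood of $\theta_0$, with derivative matrix $\kappa'(\theta)\in\mathbb R^{m\times k}$. Let $\psi_\theta\in\Psi_k$ and $\psi_\kappa\in\Psi_m$, let $\hat\theta_n=t_n(X_1,\dots,X_n)$ be an estimator of $\theta$ and let $\hat\kappa_{\theta,n}=k_n(X_1,\dots,X_n;\theta)$, $\theta\in\Theta$, be $\mathbb R^m$-valued statistics indexed by $\theta$. Suppose there is a function $c:\Theta\to\mathbb R^{m\times k}$, continuous at $\theta_0$, such that for all sequences $\{\theta_n\}\subset\Theta$ with $\{\sqrt n(\theta_n-\theta_0)\}$ bounded: (a) $\sqrt n\,\bigl|\hat\theta_n-\theta_n-\frac1n\sum_{i=1}^n\psi_\theta(X_i;\theta_n)\bigr|\to0$ in $P_{\theta_0}$-probability; (b) $\sqrt n\,\bigl|\hat\kappa_{\theta_n,n}-\kappa(\theta_n)-\frac1n\sum_{i=1}^n\psi_\kappa(X_i;\theta_n)\bigr|\to0$ in $P_{\theta_0}$-probability; (c) $\bigl|\frac1{\sqrt n}\sum_{i=1}^n\psi_\kappa(X_i;\theta_n)-\frac1{\sqrt n}\sum_{i=1}^n\psi_\kappa(X_i;\theta_0)-c(\theta_0)\sqrt n(\theta_n-\theta_0)\bigr|\to0$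 in $P_{\theta_0}$-probability. Let $\{\lambda_n\}$ be a sequence of integers with $\lambda_n/n\to\frac12$, and define the split-sample substitution estimator $$\hat\kappa_{n,2}=\frac{\lambda_n}{n}\,k_{\lambda_n}(X_1,\dots,X_{\lambda_n};\tilde\theta_{n2})+\frac{n-\lambda_n}{n}\,k_{n-\lambda_n}(X_{\lambda_n+1},\dots,X_n;\tilde\theta_{n1}),$$ where $\tilde\theta_{n1}=t_{\lambda_n}(X_1,\dots,X_{\lambda_n})$ and $\tilde\theta_{n2}=t_{n-\lambda_n}(X_{\lambda_n+1},\dots,X_n)$. Then $\hat\kappa_{n,2}$ is locally asymptotically linear for $\kappa$ at $\theta_0$ with influence function $$\tilde\psi(x;\theta)=\psi_\kappa(x;\theta)+(\kappa'(\theta)+c(\theta))\psi_\theta(x;\theta),$$ that is, for every sequence $\{\theta_n\}\subset\Theta$ with $\{\sqrt n(\theta_n-\theta_0)\}$ bounded, $$\sqrt n\,\Bigl|\hat\kappa_{n,2}-\kappa(\theta_n)-\frac1n\sum_{i=1}^n\tilde\psi(X_i;\theta_n)\Bigr|\to0\quad\text{in }P_{\theta_0}\text{-probability}.$$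
   Context: For $m\in\mathbb N$, $\Psi_m$ is the set of all measurable $\psi:\mathcal X\times\Theta\to\mathbb R^m$ such that $\int\psi(x;\theta)\,dP_\theta(x)=0$ and $\int|\psi(x;\theta)|^2\,dP_\theta(x)<\infty$ for all $\theta\in\Theta$; $|\cdot|$ is a Euclidean norm. ''In $P_{\theta_0}$-probability'' means convergence in probability when $X_1,X_2,\dots$ are i.i.d. with distribution $P_{\theta_0}$. The maps $t_n:\mathcal X^n\to\mathbb R^k$ and $k_n:\mathcal X^n\times\Theta\to\mathbb R^m$ are measurable; if an estimator of $\theta$ takes a value outside $\Theta$, the substituted statistic may be defined arbitrarily (measurably). *)

(* Defs.v *)
From HB Require Import structures.
From mathcomp Require Export all_boot all_order all_algebra.
From mathcomp Require Export all_classical all_reals all_analysis.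

#[export] Set Implicit Arguments.
#[export] Unset Strict Implicit.
#[export] Unset Printing Implicit Defensive.

Export Order.TTheory GRing.Theory Num.Theory.
Export numFieldNormedType.Exports.

Global Open Scope classical_set_scope.
Global Open Scope ring_scope.

(* R^n is 'cV[R]_n; all matrix spaces carry the Borel sigma-algebra. *)
Section borel_matrix.
Context {R : realType} {m n : nat}.

Let borel : set (set 'M[R]_(m, n)) := <<s open >>.

Let borel0 : borel set0.
Proof. exact: sigma_algebra0. Qed.

Let borelC A : borel A -> borel (~` A).
Proof. exact: sigma_algebraC. Qed.

Let borel_bigcup (F : (set 'M[R]_(m, n))^nat) :
  (forall i, borel (F i)) -> borel (\bigcup_i F i).
Proof. exact: sigma_algebra_bigcup. Qed.

HB.instance Definition _ := @isMeasurable.Build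
  (sigma_display (@open 'M[R]_(m, n))) 'M[R]_(m, n)
  borel borel0 borelC borel_bigcup.

End borel_matrix.

(* The library norm `|v| on 'cV[R]_n is the sup norm. *)
Definition enorm (R : realType) (n : nat) (v : 'cV[R]_n) : R :=
  Num.sqrt (\sum_(i < n) v i ord0 ^+ 2).

Definition derivative_mx (R : realType) (k m : nat)
    (f : 'cV[R]_k -> 'cV[R]_m) (th : 'cV[R]_k) : 'M[R]_(m, k) :=
  \matrix_(i < m, j < k) ('d f th : 'cV[R]_k -> 'cV[R]_m) (delta_mx j ord0) i ord0.

Definition C1_near (R : realType) (k m : nat)
    (f : 'cV[R]_k -> 'cV[R]_m) (th0 : 'cV[R]_k) : Prop :=
  \forall th \near th0,
    differentiable f th /\ {for th, continuous (derivative_mx f)}.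

(* A family indexed by Theta is a total function on 'cV[R]_k that is only
   ever constrained, or evaluated, at points of Theta. *)
Definition Psi (R : realType) (d : measure_display) (X : measurableType d)
    (k : nat) (Theta : set 'cV[R]_k) (P : 'cV[R]_k -> probability X R)
    (m : nat) : set (X -> 'cV[R]_k -> 'cV[R]_m) :=
  [set psi : X -> 'cV[R]_k -> 'cV[R]_m |
    measurable_fun ([set: X] `*` Theta)
      (fun z : X * 'cV[R]_k => psi z.1 z.2) /\
    forall th, Theta th ->
      (forall i, (\int[P th]_x (psi x th i ord0)%:E = 0)%E) /\
      (\int[P th]_x (enorm (psi x th) ^+ 2)%:E < +oo)%E].

Arguments Psi {R d X k} Theta P m _.

Definition mutually_independent (R : realType) (d d' : measure_display)
    (Omega : measurableType d) (X : measurableType d')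
    (Pr : probability Omega R) (Xs : nat -> {RV Pr >-> X}) : Prop :=
  forall (J : seq nat) (A : nat -> set X), uniq J ->
    (forall i, measurable (A i)) ->
    Pr (\bigcap_(i in [set` J]) Xs i @^-1` A i) =
    (\prod_(i <- J) Pr (Xs i @^-1` A i))%E.

Definition iid (R : realType) (d d' : measure_display)
    (Omega : measurableType d) (X : measurableType d')
    (Pr : probability Omega R) (Xs : nat -> {RV Pr >-> X})
    (Q : probability X R) : Prop :=
  mutually_independent Xs /\
  forall i A, measurable A -> distribution Pr (Xs i) A = Q A.

Definition cvg_in_prob (R : realType) (d : measure_display)
    (Omega : measurableType d) (Pr : probability Omega R)
    (Y : nat -> Omega -> R) (l : R) : Prop :=
  forall e : R, 0 < e ->
    Pr [set w | e <= `|Y n w - l|] @[n --> \oo] --> (0 : \bar R)%E.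

(* The n observations that follow the first s ones. Observations are numbered
   from 0 here: Xs i is the variable X_(i+1). *)
Definition sample (Omega X : Type) (Xs : nat -> Omega -> X) (s n : nat)
    (w : Omega) : n.-tuple X :=
  [tuple Xs (s + i)%N w | i < n].

Definition emp_mean (R : realType) (Omega X : Type) (Xs : nat -> Omega -> X)
    (m : nat) (f : X -> 'cV[R]_m) (n : nat) (w : Omega) : 'cV[R]_m :=
  n%:R^-1 *: \sum_(i < n) f (Xs i w).

Definition local_seq (R : realType) (k : nat) (Theta : set 'cV[R]_k)
    (th0 : 'cV[R]_k) (th : nat -> 'cV[R]_k) : Prop :=
  (forall n, Theta (th n)) /\
  exists M : R, forall n, enorm (Num.sqrt n%:R *: (th n - th0)) <= M.

Definition loc_asymp_linear (R : realType) (d d' : measure_display)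
    (Omega : measurableType d) (X : measurableType d')
    (Pr : probability Omega R) (Xs : nat -> {RV Pr >-> X})
    (k m : nat) (Theta : set 'cV[R]_k) (th0 : 'cV[R]_k)
    (T : nat -> Omega -> 'cV[R]_m) (kappa : 'cV[R]_k -> 'cV[R]_m)
    (psi : X -> 'cV[R]_k -> 'cV[R]_m) : Prop :=
  forall th, local_seq Theta th0 th ->
    cvg_in_prob Pr (fun n w => Num.sqrt n%:R *
      enorm (T n w - kappa (th n) - emp_mean Xs (psi^~ (th n)) n w)) 0.

(* kn(.; th), with the arbitrary value d when the estimate th of the parameter
   falls outside Theta. *)
Definition substitute (R : realType) (k m : nat) (Theta : set 'cV[R]_k)
    (kn : 'cV[R]_k -> 'cV[R]_m) (d : 'cV[R]_m) (th : 'cV[R]_k) : 'cV[R]_m :=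
  if th \in Theta then kn th else d.

(* dflt1 and dflt2 are the values, functions of the whole sample, used when
   the parameter estimate plugged into the first, resp. second, half is not in
   Theta. The absolute values only matter for the n, finitely many as soon as
   lam n / n --> 1/2, at which 0 <= lam n <= n fails. *)
Definition split_estimator (R : realType) (Omega X : Type)
    (Xs : nat -> Omega -> X) (k m : nat) (Theta : set 'cV[R]_k)
    (t : forall n, n.-tuple X -> 'cV[R]_k)
    (kn : forall n, n.-tuple X -> 'cV[R]_k -> 'cV[R]_m)
    (dflt1 dflt2 : forall n, n.-tuple X -> 'cV[R]_m)
    (lam : nat -> int) (n : nat) (w : Omega) : 'cV[R]_m :=
  let l1 := `|lam n|%N in
  let l2 := `|n%:Z - lam n|%N in
  let X1 := sample Xs 0 l1 w in
  let X2 := sample Xs l1 l2 w in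
  let Xn := sample Xs 0 n w in
  ((lam n)%:~R / n%:R) *:
    substitute Theta (kn l1 X1) (dflt1 n Xn) (t l2 X2) +
  ((n%:Z - lam n)%:~R / n%:R) *:
    substitute Theta (kn l2 X2) (dflt2 n Xn) (t l1 X1).

(* Main.v *)
Require Import Defs.
From mathcomp Require Import measurable_realfun lra ring zify.

(** Write [B := kappa'(th0) + c(th0)].  By (b), (c) and differentiability, the
    remainder
      [D n x th := sqrt n (k_n(x; th) - kappa(th0)) - n^(-1/2) sum psi_kappa(x_i; th0)
                   - B sqrt n (th - th0)]
    is [oP(1)] along every sequence of parameters at distance [O(1 / sqrt n)] of
    [th0]; hence [P(|D n X th| >= e)] tends to [0] uniformly over
    [sqrt n |th - th0| <= M].  Since each half of the sample is independent of the
    estimator computed from the other half, Fubini allows [th] to be replaced by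
    that estimator, which is root-n consistent by (a) and Chebyshev's inequality.
    Adding the two halves, the cross terms recombine into the full-sample sum of
    [B psi_theta] because [lam n / n] tends to [1/2].  Finally (a), (c) and the
    continuity of [kappa'] and [c] move the expansion from [th0] to [th n]. *)

(** * Independent blocks of observations *)

(** Hypothesis (b) controls [kn] only along deterministic parameters, and nothing is known about how
    [kn] varies with the parameter, so a random parameter cannot be inserted by continuity. Given
    the other half of the sample it is a constant, and the only thing left to secure is uniformity
    over root-n neighbourhoods; this follows from the freedom to choose the sequence in (b) and (c).
    The half on which [kn] is evaluated contributes its weight to the [psi_theta] sum of the
    opposite half. The weights of the two [psi_theta] sums are thus interchanged, which is harmless
    only when they agree in the limit; this is the origin of 1/2. Hypothesis (c) concerns
    [psi_kappa]. Its counterpart for [psi_theta] is a consequence of (a): one estimator is expanded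
    both at [th0] and at [th n], so the two sums differ by [- sqrt n (th n - th0)] up to [oP(1)].
    The resulting drift cancels those of [kappa] and [psi_kappa]. *)

Section independent_pair.
Local Open Scope ereal_scope.
Context (R : realType) (d d1 d2 : measure_display) (Omega : measurableType d)
  (T1 : measurableType d1) (T2 : measurableType d2) (Pr : probability Omega R).

Definition independent_rv (Y : Omega -> T1) (Z : Omega -> T2) :=
  forall A B, measurable A -> measurable B ->
    Pr (Y @^-1` A `&` Z @^-1` B) = Pr (Y @^-1` A) * Pr (Z @^-1` B).

(** As functions of [A], both sides are finite measures: the image under [Y] of [Pr] restricted to
    [C], and the law of [Y] scaled by [Pr C]. Agreement on a generating pi-system forces
    equality. *)
Lemma independent_pi_system (Y : Omega -> T1) (G : set (set T1)) (C : set Omega) :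
  measurable_fun setT Y -> measurable = <<s G >> -> setI_closed G -> G setT ->
  measurable C ->
  (forall A, G A -> Pr (Y @^-1` A `&` C) = Pr (Y @^-1` A) * Pr C) ->
  forall A, measurable A -> Pr (Y @^-1` A `&` C) = Pr (Y @^-1` A) * Pr C.
Proof.
move=> mY GE GI GT mC GC A mA.
pose Y' : {mfun Omega >-> T1} := mfun_Sub (mem_set mY).
pose c : {nonneg R} := NngNum (fine_ge0 (measure_ge0 Pr C)).
pose mu1 := pushforward (mrestr Pr mC) Y'.
pose mu2 := mscale c (distribution Pr Y').
suff : mu1 A = mu2 A.
  by rewrite /mu1 /mu2 /mscale /distribution /pushforward /mrestr/= fineK ?fin_num_measure// muleC.
apply: (measure_unique G (fun=> setT)) => //.
- by rewrite bigcup_const//; exists 0%N.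
- move=> B GB; rewrite /mu1 /mu2 /= /mscale /distribution /pushforward /mrestr /=.
  by rewrite fineK ?fin_num_measure// muleC; exact: GC.
- move=> _; rewrite /= /pushforward /mrestr preimage_setT setTI.
  by rewrite (le_lt_trans (probability_le1 _ _))// ltry.
Qed.

(* Fubini for the joint law, in the form of a conditional bound. *)
Lemma independent_pair_le (Y : Omega -> T1) (Z : Omega -> T2) (E : set (T1 * T2))
    (dlt : R) :
  measurable_fun setT Y -> measurable_fun setT Z -> independent_rv Y Z ->
  measurable E ->
  (forall y, Pr (Z @^-1` xsection E y) <= dlt%:E) ->
  Pr [set w | E (Y w, Z w)] <= dlt%:E.
Proof.
move=> mY mZ YZ mE Edlt.
pose Y' : {mfun Omega >-> T1} := mfun_Sub (mem_set mY).
pose Z' : {mfun Omega >-> T2} := mfun_Sub (mem_set mZ).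
have mYZ : measurable_fun setT (fun w => (Y w, Z w)).
  exact/measurable_fun_pair.
pose W' : {mfun Omega >-> (T1 * T2)%type} := mfun_Sub (mem_set mYZ).
have -> : Pr [set w | E (Y w, Z w)] = distribution Pr W' E by [].
rewrite -(@product_measure_unique _ _ _ _ _ (distribution Pr Y') (distribution Pr Z'))//.
rewrite /product_measure1.
apply: (@le_trans _ _ (\int[distribution Pr Y']_x (cst dlt%:E) x)).
  apply: ge0_le_integral => //.
  - exact: measurable_fun_xsection.
  - by move=> x _; apply: le_trans (Edlt x).
by rewrite integral_cst// [X in _ * X](probability_setT (distribution Pr Y')) mule1.
Qed.

End independent_pair.

(** * Laws and independence of blocks *)

Section sample.
Local Open Scope ereal_scope.
Context (R : realType) (d d' : measure_display) (Omega : measurableType d)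
  (X : measurableType d').

(** The sides are indexed by [nat], as the events in [mutually_independent] are, so that moving a
    block only shifts the index of its sides. *)
Definition cylinder n (A : nat -> set X) : set (n.-tuple X) :=
  [set x | forall i : 'I_n, A i (tnth x i)].

Definition cylinders n : set (set (n.-tuple X)) :=
  [set B | exists2 A : nat -> set X,
    forall i, measurable (A i) & B = cylinder A].

Lemma measurable_cylinder n (A : nat -> set X) : (forall i, measurable (A i)) ->
  measurable (cylinder A : set (n.-tuple X)).
Proof.
move=> mA.
have -> : cylinder A = \bigcap_(i in [set: 'I_n]) (@tnth n X ^~ i @^-1` A i).
  by apply/seteqP; split=> [x Ax i _|x Ax i]; apply: Ax.
apply: fin_bigcap_measurable; first exact: finite_finset.
by move=> i _; rewrite -[X in measurable X]setTI; exact: measurable_tnth.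
Qed.

Lemma measurable_cylinders n : @measurable _ (n.-tuple X) = <<s @cylinders n >>.
Proof.
apply/seteqP; split=> [A mA|A]; last first.
  apply: smallest_sub; first exact: sigma_algebra_measurable.
  by move=> _ [B mB ->]; exact: measurable_cylinder.
apply: (smallest_sub _ _ mA); first exact: smallest_sigma_algebra.
rewrite -bigcup_seq; apply: bigcup_sub => i _ _ [B mB <-].
apply: sub_sigma_algebra; exists (fun j => if j == i :> nat then B else setT).
  by move=> j; case: ifP.
apply/seteqP; split=> x /=; first by move=> [_ Bx] j; case: ifP => // /eqP/val_inj ->.
by move=> /(_ i); rewrite eqxx.
Qed.

Lemma setI_closed_cylinders n : setI_closed (@cylinders n).
Proof.
move=> _ _ [A mA ->] [B mB ->]; exists (fun i => A i `&` B i).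
  by move=> i; exact: measurableI.
apply/seteqP; split=> x /=; first by move=> [Ax Bx] i; split.
by move=> ABx; split=> i; have [] := ABx i.
Qed.

Lemma cylinders_setT n : @cylinders n setT.
Proof. by exists (fun=> setT) => //; apply/seteqP; split. Qed.

Variables (Pr : probability Omega R) (Xs : nat -> {RV Pr >-> X})
  (Q : probability X R).

Lemma measurable_sample s n : measurable_fun setT (sample Xs s n).
Proof.
apply/measurable_fun_tnthP => i.
rewrite (_ : _ \o _ = Xs (s + i)%N)//.
by apply/funext => w /=; rewrite tnth_mktuple.
Qed.

Hypothesis iidX : iid Xs Q.

Let probX i A : measurable A -> Pr (Xs i @^-1` A) = Q A.
Proof. by move=> mA; exact: iidX.2. Qed.

Lemma prob_sample_cylinder s n A : (forall i, measurable (A i)) ->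
  Pr (sample Xs s n @^-1` cylinder A) = \prod_(i < n) Q (A i).
Proof.
move=> mA.
have := iidX.1 (iota s n) (fun i => A (i - s)%N) (iota_uniq s n) (fun i => mA _).
have -> : \bigcap_(i in [set` iota s n]) Xs i @^-1` A (i - s)%N =
    sample Xs s n @^-1` cylinder A.
  apply/seteqP; split=> w /=.
    move=> H i; rewrite tnth_mktuple; have := H (s + i)%N.
    rewrite /= addKn mem_iota leq_addr ltn_add2l ltn_ord.
    by apply.
  move=> H i /=; rewrite mem_iota => /andP[si ilt].
  have lt : (i - s < n)%N by rewrite ltn_subLR.
  by have := H (Ordinal lt); rewrite tnth_mktuple /= subnKC.
move=> ->; rewrite -[s in iota s]addn0 iotaDl big_map.
rewrite -(big_mkord xpredT (fun i => Q (A i))) /index_iota subn0.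
by apply: eq_bigr => i _; rewrite addKn; exact: probX.
Qed.

Lemma prob_sample_cylinderI s n s' n' A B : (s + n <= s')%N ->
  (forall i, measurable (A i)) -> (forall i, measurable (B i)) ->
  Pr (sample Xs s n @^-1` cylinder A `&` sample Xs s' n' @^-1` cylinder B) =
  \prod_(i < n) Q (A i) * \prod_(i < n') Q (B i).
Proof.
move=> sn mA mB.
(* One family of events for the concatenated index list. Since [s + n <= s'], the test [i < s']
   tells the two blocks apart. *)
pose F i := if (i < s')%N then A (i - s)%N else B (i - s')%N.
have mF i : measurable (F i) by rewrite /F; case: ifP.
have uJ : uniq (iota s n ++ iota s' n').
  rewrite cat_uniq !iota_uniq andbT /=; apply/hasPn => i.
  by rewrite !mem_iota; lia.
have := iidX.1 _ F uJ mF.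
have -> : \bigcap_(i in [set` iota s n ++ iota s' n']) Xs i @^-1` F i =
    sample Xs s n @^-1` cylinder A `&` sample Xs s' n' @^-1` cylinder B.
  apply/seteqP; split=> w /=.
    move=> H; split=> i; rewrite tnth_mktuple.
      have := H (s + i)%N; rewrite /F /= addKn.
      have il := ltn_ord i; have -> : (s + i < s')%N by lia.
      by apply; rewrite mem_cat !mem_iota; lia.
    have := H (s' + i)%N; rewrite /F /= addKn.
    have il := ltn_ord i; have -> : (s' + i < s')%N = false by lia.
    by apply; rewrite mem_cat !mem_iota; lia.
  move=> [HA HB] i /=; rewrite mem_cat !mem_iota /F => /orP[/andP[si ilt]|/andP[si ilt]].
    have lt : (i - s < n)%N by lia.
    have -> : (i < s')%N by lia.
    by have := HA (Ordinal lt); rewrite tnth_mktuple /= subnKC.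
  have lt : (i - s' < n')%N by lia.
  have -> : (i < s')%N = false by lia.
  by have := HB (Ordinal lt); rewrite tnth_mktuple /= subnKC.
move=> ->; rewrite big_cat; congr (_ * _).
  rewrite -[s in iota s]addn0 iotaDl big_map.
  rewrite -(big_mkord xpredT (fun i => Q (A i))) /index_iota subn0.
  rewrite !big_seq; apply: eq_bigr => i; rewrite mem_iota => il.
  by rewrite probX// /F addKn; have -> : (s + i < s')%N by lia.
rewrite -[s' in iota s']addn0 iotaDl big_map.
rewrite -(big_mkord xpredT (fun i => Q (B i))) /index_iota subn0.
apply: eq_bigr => i _.
by rewrite probX// /F addKn; have -> : (s' + i < s')%N = false by lia.
Qed.

(** The probability of a cylinder does not involve the offset, and cylinders form a generating
    pi-system. This makes hypotheses on the first observations usable on the second half. *)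
Lemma prob_sample_shift s s' n E : measurable E ->
  Pr (sample Xs s n @^-1` E) = Pr (sample Xs s' n @^-1` E).
Proof.
move=> mE.
pose S : {mfun Omega >-> n.-tuple X} := mfun_Sub (mem_set (@measurable_sample s n)).
pose S' : {mfun Omega >-> n.-tuple X} := mfun_Sub (mem_set (@measurable_sample s' n)).
change (distribution Pr S E = distribution Pr S' E).
apply: (measure_unique (@cylinders n) (fun=> setT)) => //.
- exact: measurable_cylinders.
- exact: setI_closed_cylinders.
- by move=> _; exact: cylinders_setT.
- by rewrite bigcup_const//; exists 0%N.
- move=> _ [A mA ->]; transitivity (\prod_(i < n) Q (A i)).
    exact: prob_sample_cylinder.
  exact/esym/prob_sample_cylinder.
- by move=> _; rewrite (le_lt_trans (probability_le1 (distribution Pr S) _)) ?ltry.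
Qed.

Lemma independent_sample s n s' n' : (s + n <= s')%N ->
  independent_rv Pr (sample Xs s n) (sample Xs s' n').
Proof.
move=> sn.
have mS r p E : measurable E -> measurable (sample Xs r p @^-1` E).
  by move=> mE; rewrite -[X in measurable X]setTI; exact: measurable_sample.
(* The pi-system argument is run once per factor: here the first event stays a cylinder while the
   second becomes arbitrary, then the roles are exchanged. *)
have step A B : (forall i, measurable (A i)) -> measurable B ->
  Pr (sample Xs s n @^-1` cylinder A `&` sample Xs s' n' @^-1` B) =
  Pr (sample Xs s n @^-1` cylinder A) * Pr (sample Xs s' n' @^-1` B).
  move=> mA mB; rewrite setIC muleC.
  apply: (independent_pi_system (G := @cylinders n')) => //.
  - exact: measurable_sample.
  - exact: measurable_cylinders.
  - exact: setI_closed_cylinders.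
  - exact: cylinders_setT.
  - by apply: mS; exact: measurable_cylinder.
  - by move=> _ [B' mB' ->]; rewrite setIC muleC prob_sample_cylinderI// !prob_sample_cylinder.
move=> A B mA mB; apply: (independent_pi_system (G := @cylinders n)) => //.
- exact: measurable_sample.
- exact: measurable_cylinders.
- exact: setI_closed_cylinders.
- exact: cylinders_setT.
- exact: mS.
- by move=> _ [A' mA' ->]; exact: step.
Qed.

End sample.

(** * Second moments of centred i.i.d. sums *)

Section independent_product.
Local Open Scope ereal_scope.
Context (R : realType) (d d1 d2 : measure_display) (Omega : measurableType d)
  (T1 : measurableType d1) (T2 : measurableType d2) (Pr : probability Omega R).

(** Under the product law the inner integral is [f x] times the mean of [g], hence zero.
    Integrability, obtained from Tonelli, is part of the conclusion because expanding a squared sum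
    requires exchanging sum and integral. *)
Lemma independent_integralM0 (Y : {RV Pr >-> T1}) (Z : {RV Pr >-> T2})
    (f : T1 -> R) (g : T2 -> R) :
  independent_rv Pr Y Z -> measurable_fun setT f -> measurable_fun setT g ->
  Pr.-integrable setT (fun w => (f (Y w))%:E) ->
  Pr.-integrable setT (fun w => (g (Z w))%:E) ->
  \int[Pr]_w (g (Z w))%:E = 0 ->
  Pr.-integrable setT (fun w => (f (Y w) * g (Z w))%:E) /\
  \int[Pr]_w (f (Y w) * g (Z w))%:E = 0.
Proof.
move=> YZ mf mg intf intg g0.
have mYZ : measurable_fun setT (fun w => (Y w, Z w)) by exact/measurable_fun_pair.
pose W : {RV Pr >-> (T1 * T2)%type} := mfun_Sub (mem_set mYZ).
pose m1 := distribution Pr Y; pose m2 := distribution Pr Z.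
pose h : T1 * T2 -> \bar R := fun z => (f z.1 * g z.2)%:E.
have mh : measurable_fun [set: T1 * T2] h.
  apply/measurable_EFinP/measurable_funM.
    exact: measurableT_comp.
  exact: measurableT_comp.
have law A : measurable A -> distribution Pr W A = (m1 \x m2) A.
  by move=> mA; apply/esym/product_measure_unique.
have fin1 : \int[m1]_x `|(f x)%:E| < +oo.
  rewrite ge0_integral_distribution//; first by case/integrableP : intf.
  by apply: measurableT_comp => //; exact/measurable_EFinP.
have fin2 : \int[m2]_x `|(g x)%:E| < +oo.
  rewrite ge0_integral_distribution//; first by case/integrableP : intg.
  by apply: measurableT_comp => //; exact/measurable_EFinP.
have hE x y : `|h (x, y)| = `|(f x)%:E| * `|(g y)%:E| by rewrite -abseM -EFinM.
have int12 : (m1 \x m2).-integrable [set: T1 * T2] h.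
  apply/integrable12ltyP => //.
  under eq_integral do under eq_integral do rewrite hE.
  under eq_integral.
    move=> x _; rewrite ge0_integralZl//; last first.
      by apply: measurableT_comp => //; exact/measurable_EFinP.
    over.
  rewrite ge0_integralZr//; last 2 first.
    by apply: measurableT_comp => //; exact/measurable_EFinP.
    exact: integral_ge0.
  rewrite lte_mul_pinfty//; first exact: integral_ge0.
  by rewrite ge0_fin_numE//; exact: integral_ge0.
have intW : Pr.-integrable setT (fun w => h (W w)).
  apply/integrableP; split; first exact: measurableT_comp.
  rewrite -(@ge0_integral_distribution _ _ _ _ _ Pr W (fun z => `|h z|))//; last first.
    exact: measurableT_comp.
  rewrite (eq_measure_integral (m1 \x m2)); last by move=> A mA _; exact: law.
  by case/integrableP : int12.
split; first exact: intW.
transitivity (\int[Pr]_w (h \o W) w) => //.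
rewrite -integral_distribution// (eq_measure_integral (m1 \x m2)); last first.
  by move=> A mA _; exact: law.
rewrite -integral12_prod_meas1// (eq_integral (cst 0)) ?integral0// => x _.
rewrite /fubini_F /h/=.
under eq_integral do rewrite EFinM.
rewrite integralZl//; last first.
  apply/integrableP; split => //; exact/measurable_EFinP.
rewrite integral_distribution ?[X in _ * X]g0 ?mule0//.
exact/measurable_EFinP.
Qed.

End independent_product.

Section iid_sum.
Local Open Scope ereal_scope.
Context (R : realType) (d d' : measure_display) (Omega : measurableType d)
  (X : measurableType d').
Variables (Pr : probability Omega R) (Xs : nat -> {RV Pr >-> X})
  (Q : probability X R) (f : X -> R).
Hypothesis iidX : iid Xs Q.
Hypothesis mf : measurable_fun setT f.
Hypothesis f0 : \int[Q]_x (f x)%:E = 0.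
Hypothesis f2 : \int[Q]_x (f x ^+ 2)%:E < +oo.

Lemma independent_iid i j : i <> j -> independent_rv Pr (Xs i) (Xs j).
Proof.
move=> ij A B mA mB.
pose F l := if l == i then A else B.
have mF l : measurable (F l) by rewrite /F; case: ifP.
have u : uniq [:: i; j] by rewrite /= inE andbT; apply/eqP.
have := iidX.1 _ _ u mF.
have ji : (j == i) = false by apply/eqP => ?; exact: ij.
rewrite !big_cons big_nil mule1 {2 3}/F eqxx ji => <-.
congr (Pr _); apply/seteqP; split=> w /=.
  by move=> [Aw Bw] l; rewrite /= !inE /F => /orP[/eqP ->|/eqP ->]; rewrite ?eqxx ?ji.
move=> H; split.
  by have := H i; rewrite /F /= eqxx; apply; rewrite inE eqxx.
by have := H j; rewrite /F /= ji; apply; rewrite !inE eqxx orbT.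
Qed.

Let ge0_integral_iid i (h : X -> \bar R) : measurable_fun setT h ->
  (forall x, 0 <= h x) -> \int[Pr]_w h (Xs i w) = \int[Q]_x h x.
Proof.
move=> mh h0; rewrite -(ge0_integral_distribution (Xs i))//.
by apply: eq_measure_integral => A mA _; exact: iidX.2.
Qed.

Let mf2 : measurable_fun setT (fun x => (f x ^+ 2)%:E).
Proof. exact/measurable_EFinP/measurable_funX. Qed.

Let integrable_sqr i : Pr.-integrable setT (fun w => (f (Xs i w) ^+ 2)%:E).
Proof.
apply/integrableP; split; first exact: (measurableT_comp mf2).
under eq_integral do rewrite gee0_abs ?lee_fin ?sqr_ge0//.
rewrite (@ge0_integral_iid i (fun x => (f x ^+ 2)%:E))// => x.
by rewrite lee_fin sqr_ge0.
Qed.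

Let integrable1 i : Pr.-integrable setT (fun w => (f (Xs i w))%:E).
Proof.
(* Domination [|y| <= 1 + y ^+ 2]; constants are integrable for a probability. *)
apply: (@le_integrable _ _ _ _ _ _ _
  (fun w => (cst 1 \+ (fun w => (f (Xs i w) ^+ 2)%:E)) w)) => //.
- by apply/measurable_EFinP; exact: measurableT_comp.
- move=> w _ /=; rewrite lee_fin [leRHS]ger0_norm ?addr_ge0 ?sqr_ge0//.
  by rewrite -[X in (_ <= _ + X)%R]real_normK ?num_real//; set y := `|f _|%R; nra.
- by apply: integrableD => //; exact: finite_measure_integrable_cst.
Qed.

Let mean0 i : \int[Pr]_w (f (Xs i w))%:E = 0.
Proof.
rewrite -f0 -(integral_distribution (X := Xs i) (f := EFin \o f))//.
- by apply: eq_measure_integral => A mA _; exact: iidX.2.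
- exact/measurable_EFinP.
- exact: integrable1.
Qed.

(** The square expands into a sum over pairs of indices; independence and centring kill the
    off-diagonal pairs, leaving [n] equal diagonal terms. *)
Lemma second_moment_sum s n :
  \int[Pr]_w ((\sum_(i < n) f (Xs (s + i)%N w)) ^+ 2)%:E =
  n%:R%:E * \int[Q]_x (f x ^+ 2)%:E.
Proof.
have int (p : 'I_n * 'I_n) : Pr.-integrable setT
    (fun w => (f (Xs (s + p.1)%N w) * f (Xs (s + p.2)%N w))%:E) /\
    \int[Pr]_w (f (Xs (s + p.1)%N w) * f (Xs (s + p.2)%N w))%:E =
    if p.2 == p.1 then \int[Q]_x (f x ^+ 2)%:E else 0.
  case: p => i j /=; case: (eqVneq j i) => [->|ji].
    under [X in _ /\ X = _]eq_integral do rewrite -expr2.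
    split; last first.
      rewrite (@ge0_integral_iid (s + i)%N (fun x => (f x ^+ 2)%:E))// => x.
      by rewrite lee_fin sqr_ge0.
    by under eq_fun do rewrite -expr2; exact: integrable_sqr.
  apply: independent_integralM0 => //.
  by apply: independent_iid => /eqP; rewrite eqn_add2l eq_sym; exact/negP.
have -> : \int[Pr]_w ((\sum_(i < n) f (Xs (s + i)%N w)) ^+ 2)%:E =
    \int[Pr]_w (\sum_(p : 'I_n * 'I_n) (f (Xs (s + p.1)%N w) * f (Xs (s + p.2)%N w))%:E)%R.
  apply: eq_integral => w _.
  by rewrite expr2 big_distrlr /= pair_bigA sumEFin.
rewrite integral_sum//; last by move=> p; exact: (int p).1.
under eq_bigr do rewrite (int _).2.
rewrite -(pair_bigA _ (fun i j => if j == i then \int[Q]_x (f x ^+ 2)%:E else 0))/=.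
under eq_bigr do rewrite -big_mkcond big_pred1_eq.
have fin : \int[Q]_x (f x ^+ 2)%:E \is a fin_num.
  rewrite ge0_fin_numE//; apply: integral_ge0 => x _.
  by rewrite lee_fin sqr_ge0.
rewrite -(fineK fin) sumEFin -EFinM sumr_const card_ord mulr_natl//.
Qed.

(** Chebyshev's inequality; the bound is free of [s] and [n], which is what tightness of the
    normalized sums over arbitrary blocks requires. *)
Lemma prob_sum_ge s n (M : R) : (0 < n)%N -> (0 < M)%R ->
  Pr [set w | (M <= `|(Num.sqrt n%:R)^-1 * \sum_(i < n) f (Xs (s + i)%N w)|)%R] <=
  (M ^- 2)%:E * \int[Q]_x (f x ^+ 2)%:E.
Proof.
move=> n0 M0.
have n0' : (0 < n%:R :> R)%R by rewrite ltr0n.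
pose S w := (\sum_(i < n) f (Xs (s + i)%N w))%R.
have mS : measurable_fun setT S.
  by apply: measurable_sum => i; exact: measurableT_comp.
have fin : \int[Q]_x (f x ^+ 2)%:E \is a fin_num.
  rewrite ge0_fin_numE//; apply: integral_ge0 => x _.
  by rewrite lee_fin sqr_ge0.
(* Markov's inequality is applied to the squared sum at level [M ^+ 2 * n], the square of the level
   [M * sqrt n] for the sum. *)
have a0 : (0 < M ^+ 2 * n%:R)%R by rewrite mulr_gt0 ?exprn_gt0.
have := @le_integral_abse _ _ _ Pr setT measurableT (fun w => (S w ^+ 2)%:E) _
  (iffRL (measurable_EFinP _ _) (measurable_funX 2 mS)) a0.
rewrite setTI; under eq_integral do rewrite gee0_abs ?lee_fin ?sqr_ge0//.
rewrite second_moment_sum.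
have -> : [set x | (M ^+ 2 * n%:R)%:E <= `|(S x ^+ 2)%:E|] =
  [set w | (M <= `|(Num.sqrt n%:R)^-1 * \sum_(i < n) f (Xs (s + i)%N w)|)%R].
  apply/funext => w /=; apply/propext.
  rewrite -/(S w) lee_fin normrX normrM normfV (ger0_norm (sqrtr_ge0 _)).
  rewrite -[X in (_ * X <= _)%R](@sqr_sqrtr _ n%:R) ?ler0n// -exprMn.
  rewrite ler_pXn2r ?nnegrE ?(mulr_ge0 (ltW M0)) ?sqrtr_ge0//.
  by rewrite ler_pdivlMl ?sqrtr_gt0// [(M * _)%R]mulrC.
move=> H; rewrite -(@lee_pmul2l _ (M ^+ 2 * n%:R)%:E)// ?lte_fin//.
apply: (le_trans H); move: fin => /fineK <-; rewrite -!EFinM lee_fin.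
by rewrite le_eqVlt; apply/orP; left; apply/eqP; field; rewrite lt0r_neq0.
Qed.

End iid_sum.

(** * Stochastic order symbols *)

Section in_probability.
Context (R : realType) (d : measure_display) (Omega : measurableType d)
  (Pr : probability Omega R).
Implicit Types V W : normedModType R.

(* Phrased with a measurable exceptional set, so that [Q] itself need not be
   measurable. *)
Definition likely (dlt : R) (Q : Omega -> Prop) :=
  exists A, [/\ measurable A, (Pr A <= dlt%:E)%E & forall w, ~ A w -> Q w].

Definition oP V (Y : nat -> Omega -> V) := forall e dlt : R, 0 < e -> 0 < dlt ->
  \forall n \near \oo, likely dlt (fun w => `|Y n w| <= e).

Definition OP V (Y : nat -> Omega -> V) := forall dlt : R, 0 < dlt ->
  exists2 M, 0 < M & \forall n \near \oo, likely dlt (fun w => `|Y n w| <= M).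

Lemma likelyW dlt (Q1 Q2 : Omega -> Prop) : (forall w, Q1 w -> Q2 w) ->
  likely dlt Q1 -> likely dlt Q2.
Proof. by move=> Q12 [A [mA PA AQ]]; exists A; split=> // w /AQ/Q12. Qed.

Lemma likelyT dlt (Q : Omega -> Prop) : 0 <= dlt -> (forall w, Q w) -> likely dlt Q.
Proof. by move=> dlt0 QT; exists set0; rewrite measure0 lee_fin. Qed.

Lemma likelyI dlt (Q1 Q2 : Omega -> Prop) :
  likely (dlt / 2) Q1 -> likely (dlt / 2) Q2 -> likely dlt (fun w => Q1 w /\ Q2 w).
Proof.
move=> [A [mA PA AQ]] [B [mB PB BQ]]; exists (A `|` B); split.
- exact: measurableU.
- rewrite (le_trans (measureU2 _ _ _))// [dlt in (_ <= dlt%:E)%E]splitr EFinD.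
  exact: leeD.
- by move=> w /not_orP[/AQ ? /BQ ?].
Qed.

Lemma oP_le V W (C : R) (Y : nat -> Omega -> V) (Z : nat -> Omega -> W) :
  (\forall n \near \oo, forall w, `|Z n w| <= C * `|Y n w|) -> oP Y -> oP Z.
Proof.
move=> ZY oY e dlt e0 dlt0.
(* [|C| + 1] is a positive constant above [C] whatever the sign of [C], so it can be divided by. *)
have C0 : 0 < `|C| + 1 by rewrite ltr_wpDl.
have := oY (e / (`|C| + 1)) dlt (divr_gt0 e0 C0) dlt0.
apply: filterS2 ZY => n ZY; apply: likelyW => w Yw.
rewrite (le_trans (ZY w))// (@le_trans _ _ ((`|C| + 1) * `|Y n w|))//.
  by rewrite ler_wpM2r// (le_trans (ler_norm _))// lerDl.
by rewrite mulrC -ler_pdivlMr.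
Qed.

Lemma eq_oP V (Y Z : nat -> Omega -> V) :
  (\forall n \near \oo, forall w, Z n w = Y n w) -> oP Y -> oP Z.
Proof.
by move=> ZY; apply: (@oP_le _ _ 1); apply: filterS ZY => n ZY w; rewrite ZY mul1r.
Qed.

Lemma oPD V (Y Z : nat -> Omega -> V) :
  oP Y -> oP Z -> oP (fun n w => Y n w + Z n w).
Proof.
move=> oY oZ e dlt e0 dlt0.
have e20 : 0 < e / 2 by rewrite divr_gt0.
have dlt20 : 0 < dlt / 2 by rewrite divr_gt0.
have := oZ _ _ e20 dlt20; apply: filterS2 (oY _ _ e20 dlt20) => n H1 H2.
apply: likelyW (likelyI H1 H2) => w [Yw Zw].
by rewrite (le_trans (ler_normD _ _))// [leRHS]splitr lerD.
Qed.

Lemma oPB V (Y Z : nat -> Omega -> V) :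
  oP Y -> oP Z -> oP (fun n w => Y n w - Z n w).
Proof.
move=> oY oZ; apply: oPD => //; apply: (oP_le (C := 1)) oZ.
by near=> n => w; rewrite normrN mul1r lexx.
Unshelve. all: by end_near. Qed.

Lemma OP_le V W (C : R) (Y : nat -> Omega -> V) (Z : nat -> Omega -> W) :
  (\forall n \near \oo, forall w, `|Z n w| <= C * `|Y n w|) -> OP Y -> OP Z.
Proof.
move=> ZY OY dlt dlt0; have [M M0 YM] := OY dlt dlt0.
have C0 : 0 < `|C| + 1 by rewrite ltr_wpDl.
exists ((`|C| + 1) * M); first exact: mulr_gt0.
apply: filterS2 ZY YM => n ZY; apply: likelyW => w Yw.
rewrite (le_trans (ZY w))// (@le_trans _ _ ((`|C| + 1) * `|Y n w|))//.
  by rewrite ler_wpM2r// (le_trans (ler_norm _))// lerDl.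
by rewrite ler_pM2l.
Qed.

Lemma OPD V (Y Z : nat -> Omega -> V) :
  OP Y -> OP Z -> OP (fun n w => Y n w + Z n w).
Proof.
move=> OY OZ dlt dlt0.
have dlt20 : 0 < dlt / 2 by rewrite divr_gt0.
have [M M0 YM] := OY _ dlt20; have [N N0 ZN] := OZ _ dlt20.
exists (M + N); first exact: addr_gt0.
apply: filterS2 YM ZN => n H1 H2.
apply: likelyW (likelyI H1 H2) => w [Yw Zw].
by rewrite (le_trans (ler_normD _ _))// lerD.
Qed.

Lemma oP_OP V (Y : nat -> Omega -> V) : oP Y -> OP Y.
Proof. by move=> oY dlt dlt0; exists 1 => //; exact: oY. Qed.

Lemma OP_bounded V (M : R) (Y : nat -> Omega -> V) :
  (\forall n \near \oo, forall w, `|Y n w| <= M) -> OP Y.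
Proof.
move=> YM dlt dlt0; exists (`|M| + 1); first by rewrite ltr_wpDl.
apply: filterS YM => n YM; apply: likelyT; first exact: ltW.
by move=> w; rewrite (le_trans (YM w))// (le_trans (ler_norm _))// lerDl.
Qed.

Lemma oP_cvg0M V W (a : nat -> R) (Y : nat -> Omega -> V) (Z : nat -> Omega -> W) :
  a n @[n --> \oo] --> 0 ->
  (\forall n \near \oo, forall w, `|Z n w| <= `|a n| * `|Y n w|) -> OP Y -> oP Z.
Proof.
move=> a0 ZY OY e dlt e0 dlt0; have [M M0 YM] := OY _ dlt0.
move/cvgr0_norm_le : a0 => /(_ (e / M) (divr_gt0 e0 M0)) aM.
near=> n.
have ZYn : forall w, `|Z n w| <= `|a n| * `|Y n w| by near: n.
have aMn : `|a n| <= e / M by near: n.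
have : likely dlt (fun w => `|Y n w| <= M) by near: n.
apply: likelyW => w Yw; rewrite (le_trans (ZYn w))//.
by rewrite (le_trans (ler_pM _ _ aMn Yw))// divfK// gt_eqF.
Unshelve. all: by end_near. Qed.

Lemma oP_cvg0 V (a : nat -> R) (Z : nat -> Omega -> V) :
  a n @[n --> \oo] --> 0 ->
  (\forall n \near \oo, forall w, `|Z n w| <= `|a n|) -> oP Z.
Proof.
move=> a0 Za; apply: (oP_cvg0M a0 (Y := fun _ _ => 1 : R^o)).
  by apply: filterS Za => n Za w; rewrite normr1 mulr1.
by apply: (@OP_bounded _ 1); near=> n => w; rewrite normr1.
Unshelve. all: by end_near. Qed.

Lemma cvg_in_prob_oP V (Y : nat -> Omega -> V) (Z : nat -> Omega -> R) :
  (forall n (e : R), measurable [set w | e <= `|Z n w - 0|]) ->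
  (\forall n \near \oo, forall w, `|Y n w| <= Z n w) ->
  cvg_in_prob Pr Z 0 -> oP Y.
Proof.
move=> mZ YZ cZ e dlt e0 dlt0.
have /fine_cvgP[fZ] := cZ e e0.
move/cvgr0_norm_le => /(_ _ dlt0) H.
near=> n; exists [set w | e <= `|Z n w - 0|]; split => //.
- have fin : Pr [set w | e <= `|Z n w - 0|] \is a fin_num by near: n.
  rewrite -(fineK fin) lee_fin (le_trans (ler_norm _))//.
  by near: n.
- move=> w /negP; rewrite -ltNge subr0 => /ltW; apply: le_trans.
  by rewrite (le_trans _ (ler_norm _))//; move: w; near: n.
Unshelve. all: by end_near. Qed.

Lemma oP_cvg_in_prob V (Y : nat -> Omega -> V) (Z : nat -> Omega -> R) (C : R) :
  (forall n (e : R), measurable [set w | e <= `|Z n w - 0|]) ->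
  (\forall n \near \oo, forall w, `|Z n w| <= C * `|Y n w|) ->
  oP Y -> cvg_in_prob Pr Z 0.
Proof.
move=> mZ ZY oY e e0; apply/fine_cvgP; split.
  by near=> n; exact: fin_num_measure.
apply/cvgr0Pnorm_le => dlt dlt0.
have oZ : oP (Z : nat -> Omega -> R^o) by exact: oP_le ZY oY.
(* The inequality inside [oP] is not strict; halving the level makes it incompatible with
   [e <= |Z n w|]. *)
have := oZ (e / 2) dlt (divr_gt0 e0 _) dlt0; rewrite ltr0n => /(_ isT).
apply: filterS => n [A [mA PA AZ]].
rewrite /= ger0_norm ?fine_ge0// -lee_fin fineK ?fin_num_measure//.
apply: le_trans PA; apply: le_measure; rewrite ?inE// => w /=; rewrite subr0 => eZ.
apply: contrapT => /AZ Ze; move: (le_trans eZ Ze); lra.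
Unshelve. all: by end_near. Qed.

End in_probability.

(** * Sup and Euclidean norms, and first-order expansions along local sequences *)

Section matrix_norms.
Context (R : realType).

Lemma mx_entry_le m n (A : 'M[R]_(m, n)) i j : `|A i j| <= `|A|.
Proof.
rewrite [leRHS]/Num.Def.normr /= mx_normrE.
exact: (le_bigmax (0 : R) (fun ij => `|A ij.1 ij.2|) (i, j)).
Qed.

Lemma mx_norm_le m n (A : 'M[R]_(m, n)) c : 0 <= c ->
  (forall i j, `|A i j| <= c) -> `|A| <= c.
Proof.
move=> c0 Ac; rewrite [leLHS]/Num.Def.normr /= mx_normrE.
by apply/bigmax_leP; split=> // -[i j] _; exact: Ac.
Qed.

Lemma norm_mulmx_le m n p (A : 'M[R]_(m, n)) (B : 'M[R]_(n, p)) :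
  `|A *m B| <= n%:R * `|A| * `|B|.
Proof.
apply: mx_norm_le => [|i j]; first by rewrite !mulr_ge0.
rewrite mxE (le_trans (ler_norm_sum _ _ _))//.
rewrite -mulrA mulr_natl -[n in _ *+ n]card_ord -sumr_const ler_sum// => l _.
by rewrite normrM ler_pM// mx_entry_le.
Qed.

Lemma norm_le_enorm n (v : 'cV[R]_n) : `|v| <= enorm v.
Proof.
apply: mx_norm_le => [|i j]; first exact: sqrtr_ge0.
rewrite (ord1 j) -sqrtr_sqr ler_wsqrtr// (bigD1 i)//= lerDl.
by apply: sumr_ge0 => l _; rewrite sqr_ge0.
Qed.

Lemma enorm_le_norm n (v : 'cV[R]_n) : enorm v <= Num.sqrt n%:R * `|v|.
Proof.
rewrite -[`|v|]ger0_norm// -sqrtr_sqr -sqrtrM// ler_wsqrtr//.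
rewrite mulr_natl -[n in _ *+ n]card_ord -sumr_const ler_sum// => i _.
by rewrite -[leLHS]real_normK ?num_real// ler_pXn2r ?nnegrE// mx_entry_le.
Qed.

Lemma enorm_ge0 n (v : 'cV[R]_n) : 0 <= enorm v.
Proof. exact: sqrtr_ge0. Qed.

Lemma derivative_mxE k m (f : 'cV[R]_k -> 'cV[R]_m) th h :
  differentiable f th -> 'd f th h = derivative_mx f th *m h.
Proof.
move=> df.
have hE : h = \sum_(j < k) h j ord0 *: delta_mx j ord0.
  rewrite [LHS]matrix_sum_delta; apply: eq_bigr => j _.
  by rewrite big_ord1.
rewrite {1}hE linear_sum; apply/matrixP => i j; rewrite (ord1 j) !mxE summxE.
by apply: eq_bigr => l _; rewrite linearZ /= !mxE mulrC.
Qed.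

Lemma sqrt_infty (A : R) : \forall n \near \oo, A <= Num.sqrt n%:R.
Proof.
near=> n; rewrite (le_trans (ler_norm _))// -sqrtr_sqr ler_wsqrtr//.
by near: n; exact: nbhs_infty_ger.
Unshelve. all: by end_near. Qed.

Lemma local_seq_cvg k (th : 'cV[R]_k) (u : nat -> 'cV[R]_k) (M : R) :
  (forall n, `|Num.sqrt n%:R *: (u n - th)| <= M) -> u n @[n --> \oo] --> th.
Proof.
move=> uM; apply/cvgrPdist_le => e e0; near=> n.
have sn : Num.sqrt n%:R >= (`|M| + 1) / e by near: n; exact: sqrt_infty.
have sn0 : 0 < Num.sqrt n%:R :> R by rewrite (lt_le_trans _ sn)// divr_gt0// ltr_wpDl.
rewrite distrC -(ler_pM2l sn0) -{1}[Num.sqrt _]gtr0_norm// -normrZ (le_trans (uM n))//.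
rewrite (le_trans (ler_norm _))// (@le_trans _ _ (`|M| + 1)) ?lerDl//.
by rewrite -ler_pdivrMr.
Unshelve. all: by end_near. Qed.

(** The Fréchet remainder is eventually at most [e / (|M| + 1)] times the norm of [u n - th], and
    the factor [sqrt n] turns that norm into a quantity bounded by [M]. *)
Lemma differentiable_local_seq k m (f : 'cV[R]_k -> 'cV[R]_m) (th : 'cV[R]_k)
    (u : nat -> 'cV[R]_k) (M : R) : differentiable f th ->
  (forall n, `|Num.sqrt n%:R *: (u n - th)| <= M) ->
  `|Num.sqrt n%:R *: (f (u n) - f th - derivative_mx f th *m (u n - th))|
    @[n --> \oo] --> 0.
Proof.
move=> df uM; apply/cvgr0Pnorm_le => e e0.
have M0 : 0 < `|M| + 1 by rewrite ltr_wpDl.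
have /eqaddoP/(_ (e / (`|M| + 1)) (divr_gt0 e0 M0)) small := diff_locally df.
have cu : u n - th @[n --> \oo] --> (0 : 'cV[R]_k).
  by rewrite -[X in _ --> X](subrr th); apply: cvgB; [exact: local_seq_cvg uM|exact: cvg_cst].
have : \forall n \near \oo,
    `|(f \o shift th - (cst (f th) + 'd f th)) (u n - th)| <=
    e / (`|M| + 1) * `|u n - th| by exact: (cu _ small).
apply: filterS => n.
rewrite !fctE /= subrK opprD addrA derivative_mxE// => sm.
rewrite normr_id normrZ.
have sn0 : 0 <= `|Num.sqrt n%:R : R| by [].
rewrite (le_trans (ler_wpM2l sn0 sm))// mulrCA -normrZ.
rewrite (@le_trans _ _ (e / (`|M| + 1) * (`|M| + 1)))//; last by rewrite divfK// gt_eqF.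
rewrite ler_pM2l ?divr_gt0// (le_trans (uM n))// (le_trans (ler_norm _))//.
by rewrite lerDl.
Qed.


End matrix_norms.

(** * Coordinatewise measurability *)

Section coord_measurable.
Context (R : realType) (d : measure_display) (T : measurableType d).

(** With this notion the algebra of matrix-valued maps reduces to that of real measurable functions;
    Borel measurable maps enter it through [measurable_fun_coord]. *)
Definition coord_measurable m n (D : set T) (f : T -> 'M[R]_(m, n)) :=
  forall i j, measurable_fun D (fun x => f x i j).

Lemma measurable_coord m n i j :
  measurable_fun [set: 'M[R]_(m, n)] (fun A : 'M[R]_(m, n) => A i j).
Proof.
apply: (measurability _ (RGenOInfty.measurableE R)) => _ [_ [x ->] <-]; rewrite setTI.
apply: sub_sigma_algebra.
by apply: open_comp; [move=> ? _; exact: coord_continuous|exact: rray_open].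
Qed.

Lemma measurable_fun_coord m n (D : set T) (f : T -> 'M[R]_(m, n)) :
  measurable_fun D f -> coord_measurable D f.
Proof. by move=> mf i j; exact: (measurableT_comp (@measurable_coord m n i j)). Qed.

Lemma coord_measurable_cst m n D (A : 'M[R]_(m, n)) : coord_measurable D (fun=> A).
Proof. by move=> i j; exact: measurable_cst. Qed.

Lemma coord_measurableD m n D (f g : T -> 'M[R]_(m, n)) :
  coord_measurable D f -> coord_measurable D g ->
  coord_measurable D (fun x => f x + g x).
Proof.
move=> mf mg i j; under eq_fun do rewrite mxE.
exact: measurable_funD.
Qed.

Lemma coord_measurableB m n D (f g : T -> 'M[R]_(m, n)) :
  coord_measurable D f -> coord_measurable D g ->
  coord_measurable D (fun x => f x - g x).
Proof.
move=> mf mg i j; under eq_fun do rewrite !mxE.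
exact: measurable_funB.
Qed.

Lemma coord_measurable_sum m n D I (s : seq I) (h : I -> T -> 'M[R]_(m, n)) :
  (forall i, coord_measurable D (h i)) ->
  coord_measurable D (fun x => \sum_(i <- s) h i x).
Proof.
move=> mh i j; under eq_fun do rewrite summxE.
by apply: measurable_sum => l; exact: mh.
Qed.

Lemma coord_measurableM m n p D (A : 'M[R]_(m, n)) (f : T -> 'M[R]_(n, p)) :
  coord_measurable D f -> coord_measurable D (fun x => A *m f x).
Proof.
move=> mf i j; under eq_fun do rewrite !mxE.
by apply: measurable_sum => l; exact: measurable_funM.
Qed.

Lemma coord_measurableZ m n D (a : R) (f : T -> 'M[R]_(m, n)) :
  coord_measurable D f -> coord_measurable D (fun x => a *: f x).
Proof.
move=> mf i j; under eq_fun do rewrite !mxE.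
exact: measurable_funM.
Qed.

Lemma measurable_enorm n D (f : T -> 'cV[R]_n) : coord_measurable D f ->
  measurable_fun D (fun x => enorm (f x)).
Proof.
move=> mf; apply: (@measurableT_comp _ _ _ _ _ _ (@Num.sqrt R)).
  by apply: continuous_measurable_fun; exact: sqrt_continuous.
by apply: measurable_sum => i; exact: measurable_funX.
Qed.

(** The event is kept in the shape in which [cvg_in_prob] with limit 0 produces it. *)
Lemma measurable_enorm_ge n D (a e : R) (f : T -> 'cV[R]_n) :
  measurable D -> coord_measurable D f ->
  measurable (D `&` [set x | e <= `|a * enorm (f x) - 0|]).
Proof.
move=> mD mf; under eq_set do rewrite subr0.
apply: (@measurable_fun_le _ _ _ _ (cst e)) => //.
apply: measurableT_comp => //; apply: measurable_funM => //.
exact: measurable_enorm.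
Qed.

Lemma measurable_enorm_geT n (a e : R) (f : T -> 'cV[R]_n) :
  coord_measurable setT f -> measurable [set x | e <= `|a * enorm (f x) - 0|].
Proof. by move=> mf; rewrite -[X in measurable X]setTI; exact: measurable_enorm_ge. Qed.

End coord_measurable.

Lemma coord_measurable_comp (R : realType) (d d' : measure_display)
    (T : measurableType d) (T' : measurableType d') m n (D : set T)
    (E : set T') (g : T' -> T) (f : T -> 'M[R]_(m, n)) :
  measurable D -> g @` E `<=` D -> measurable_fun E g -> coord_measurable D f ->
  coord_measurable E (fun x => f (g x)).
Proof.
by move=> mD gED mg mf i j; apply: (measurable_comp mD gED (mf i j) mg).
Qed.


Lemma measurable_open (R : realType) m n (A : set 'M[R]_(m, n)) :
  open A -> measurable A.
Proof. exact: sub_sigma_algebra. Qed.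

(** * Statistics of blocks of observations *)

Lemma independent_rv_sym (R : realType) (d d1 d2 : measure_display)
    (Omega : measurableType d) (T1 : measurableType d1) (T2 : measurableType d2)
    (Pr : probability Omega R) (Y : Omega -> T1) (Z : Omega -> T2) :
  independent_rv Pr Y Z -> independent_rv Pr Z Y.
Proof. by move=> YZ A B mA mB; rewrite setIC muleC YZ. Qed.

Section order_symbols_of_vectors.
Context (R : realType) (d : measure_display) (Omega : measurableType d)
  (Pr : probability Omega R).

Lemma OP_sum (V : normedModType R) I (r : seq I) (Y : I -> nat -> Omega -> V) :
  (forall i, OP Pr (Y i)) -> OP Pr (fun n w => \sum_(i <- r) Y i n w).
Proof.
move=> OY; elim: r => [|i r ih].
  by apply: (@OP_bounded _ _ _ _ _ 0); near=> n => w; rewrite big_nil normr0.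
have := OPD (OY i) ih; apply: (@OP_le _ _ _ _ _ _ 1).
by near=> n => w; rewrite big_cons mul1r.
Unshelve. all: by end_near. Qed.

(** Chebyshev's inequality is available for real sums; a finite expansion in the standard basis
    carries tightness over to vectors. *)
Lemma OP_coord k (Y : nat -> Omega -> 'cV[R]_k) :
  (forall j, OP Pr (fun n w => Y n w j ord0 : R^o)) -> OP Pr Y.
Proof.
move=> OY.
suff : OP Pr (fun n w => \sum_(j < k) Y n w j ord0 *: (delta_mx j ord0 : 'cV[R]_k)).
  apply: (@OP_le _ _ _ _ _ _ 1); near=> n => w; rewrite mul1r.
  rewrite {1}[Y n w]matrix_sum_delta le_eqVlt; apply/orP; left; apply/eqP.
  by congr `|_|; apply: eq_bigr => j _; rewrite big_ord1.
apply: OP_sum => j; move: (OY j).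
apply: (@OP_le _ _ _ _ _ _ `|delta_mx j ord0 : 'cV[R]_k|).
by near=> n => w; rewrite normrZ mulrC.
Unshelve. all: by end_near. Qed.

Lemma oP_enorm_ge m (Y : nat -> Omega -> 'cV[R]_m) (e dlt : R) :
  (forall n, coord_measurable setT (Y n)) -> oP Pr Y -> 0 < e -> 0 < dlt ->
  \forall n \near \oo, (Pr [set w | (e <= enorm (Y n w))%R] <= dlt%:E)%E.
Proof.
move=> mY oY e0 dlt0.
have C0 : 0 < Num.sqrt m%:R + 1 :> R by rewrite ltr_wpDl ?sqrtr_ge0.
(* [oP] uses the sup norm: the factor [sqrt m], increased by 1 to stay positive, pays for the
   Euclidean norm, and the final 2 makes the inequality strict. *)
have e'0 : 0 < e / (Num.sqrt m%:R + 1) / 2 by rewrite !divr_gt0.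
have := oY _ _ e'0 dlt0; apply: filterS => n [A [mA PA AY]].
apply: le_trans PA; apply: le_measure; rewrite ?inE//.
  have := measurable_enorm_geT 1 e (mY n).
  by under eq_set do rewrite mul1r subr0 ger0_norm ?enorm_ge0//.
move=> w /= eY; apply: contrapT => /AY Ye.
move: eY; rewrite leNgt => /negP; apply.
apply: (le_lt_trans (enorm_le_norm _)).
apply: (@le_lt_trans _ _ ((Num.sqrt m%:R + 1) * `|Y n w|)).
  by rewrite ler_wpM2r// lerDl.
rewrite (le_lt_trans (ler_wpM2l (ltW C0) Ye))//.
have -> : (Num.sqrt m%:R + 1) * (e / (Num.sqrt m%:R + 1) / 2) = e / 2.
  by field; rewrite gt_eqF.
by rewrite ltr_pdivrMr// ltr_pMr// ltr1n.
Qed.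

End order_symbols_of_vectors.

Section block_statistics.
Context (R : realType) (d d' : measure_display) (Omega : measurableType d)
  (X : measurableType d') (Pr : probability Omega R) (Xs : nat -> {RV Pr >-> X})
  (Q : probability X R).
Hypothesis iidX : iid Xs Q.

(** A function of a tuple and not of the sample point, so that one statistic can be evaluated on any
    block. *)
Definition root_sum m (f : X -> 'cV[R]_m) n (x : n.-tuple X) : 'cV[R]_m :=
  (Num.sqrt n%:R)^-1 *: \sum_(i < n) f (tnth x i).

Lemma root_sum_sample m (f : X -> 'cV[R]_m) s n w :
  root_sum f (sample Xs s n w) =
  (Num.sqrt n%:R)^-1 *: \sum_(i < n) f (Xs (s + i)%N w).
Proof. by congr (_ *: _); apply: eq_bigr => i _; rewrite tnth_mktuple. Qed.

Lemma coord_measurable_root_sum m (f : X -> 'cV[R]_m) n :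
  coord_measurable setT f ->
  coord_measurable [set: n.-tuple X] (fun x => root_sum f x).
Proof.
move=> mf; apply: coord_measurableZ; apply: coord_measurable_sum => i.
by apply: (coord_measurable_comp (D := setT)) => //; exact: measurable_tnth.
Qed.

Lemma coord_measurable_sample m n s (f : n.-tuple X -> 'cV[R]_m) :
  coord_measurable setT f -> coord_measurable setT (fun w => f (sample Xs s n w)).
Proof.
by move=> mf; apply: (coord_measurable_comp (D := setT)) => //; exact: measurable_sample.
Qed.

Lemma measurable_tuple_enorm_ge m n (f : n.-tuple X -> 'cV[R]_m) (e : R) :
  coord_measurable setT f -> measurable [set x | e <= enorm (f x)].
Proof.
move=> mf; have := measurable_enorm_geT 1 e mf.
by under eq_set do rewrite mul1r subr0 ger0_norm ?enorm_ge0//.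
Qed.

(** Events about a block have the same probability as those about the first [l n] observations, and
    these are small once [l n] is large. *)
Lemma oP_sample_shift m (g : forall n, n.-tuple X -> 'cV[R]_m) (s l : nat -> nat) :
  (forall n, coord_measurable setT (g n)) -> l n @[n --> \oo] --> \oo ->
  oP Pr (fun n w => g n (sample Xs 0 n w)) ->
  oP Pr (fun n w => g (l n) (sample Xs (s n) (l n) w)).
Proof.
move=> mg loo og e dlt e0 dlt0.
have := oP_enorm_ge (fun n => coord_measurable_sample 0 (mg n)) og e0 dlt0.
move/loo => /=; rewrite /nbhs/= => -[N _ lN]; exists N => // n /lN /= Ple.
exists (sample Xs (s n) (l n) @^-1` [set x | e <= enorm (g (l n) x)]).
have mE := measurable_tuple_enorm_ge e (mg (l n)).
split.
- by rewrite -[X in measurable X]setTI; exact: measurable_sample.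
- by rewrite (prob_sample_shift iidX _ 0%N).
- by move=> w /= /negP; rewrite -ltNge => /ltW; exact: le_trans (norm_le_enorm _).
Qed.

Lemma OP_root_sum m (f : X -> 'cV[R]_m) (s l : nat -> nat) :
  coord_measurable setT f -> l n @[n --> \oo] --> \oo ->
  (forall i, (\int[Q]_x (f x i ord0)%:E = 0)%E) ->
  (\int[Q]_x (enorm (f x) ^+ 2)%:E < +oo)%E ->
  OP Pr (fun n w => root_sum f (sample Xs (s n) (l n) w)).
Proof.
move=> mf loo f0 f2.
suff OY j : OP Pr (fun n w => root_sum f (sample Xs (s n) (l n) w) j ord0 : R^o).
  exact: OP_coord.
move=> dlt dlt0.
have fj2 : (\int[Q]_x (f x j ord0 ^+ 2)%:E < +oo)%E.
  apply: le_lt_trans f2; apply: ge0_le_integral => //.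
  - by move=> x _; rewrite lee_fin sqr_ge0.
  - by apply/measurable_EFinP/measurable_funX; exact: mf.
  - by apply/measurable_EFinP/measurable_funX; exact: measurable_enorm.
  move=> x _; rewrite lee_fin sqr_sqrtr; last first.
    by apply: sumr_ge0 => i _; rewrite sqr_ge0.
  by rewrite (bigD1 j)//= lerDl; apply: sumr_ge0 => i _; rewrite sqr_ge0.
set v := (\int[Q]_x (f x j ord0 ^+ 2)%:E)%E in fj2.
have v0 : (0 <= v)%E by apply: integral_ge0 => x _; rewrite lee_fin sqr_ge0.
have vfin : v \is a fin_num by rewrite ge0_fin_numE.
(* Chosen so that [M ^+ 2] is at least [v / dlt], which bounds the Chebyshev quotient by [dlt];
   adding 1 keeps [M] positive when [v] is 0. *)
pose M := Num.sqrt (fine v / dlt) + 1.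
have M0 : 0 < M by rewrite /M ltr_wpDl ?sqrtr_ge0.
exists M => //.
have [N _ lN] : \forall n \near \oo, (0 < l n)%N.
  exact: (loo _ (nbhs_infty_gt 0)).
exists N => // n /lN /= l0.
have mfj : measurable_fun setT (fun x => f x j ord0) by exact: mf.
exists [set w | M <= `|(Num.sqrt (l n)%:R)^-1 *
                       \sum_(i < l n) f (Xs (s n + i)%N w) j ord0|]; split.
- rewrite -[X in measurable X]setTI.
  apply: (@measurable_fun_le _ _ _ _ (cst M)) => //.
  apply: measurableT_comp => //; apply: measurable_funM => //.
  by apply: measurable_sum => i; exact: (measurableT_comp mfj).
- apply: le_trans (prob_sum_ge iidX mfj (f0 j) fj2 (s n) l0 M0) _.
  rewrite -/v -(fineK vfin) -EFinM lee_fin mulrC ler_pdivrMr ?exprn_gt0//.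
  rewrite mulrC -ler_pdivrMr//.
  have q0 : 0 <= fine v / dlt by rewrite divr_ge0 ?fine_ge0// ltW.
  rewrite -[leLHS](sqr_sqrtr q0) ler_pXn2r ?nnegrE ?sqrtr_ge0// ?lerDl//.
  exact: ltW.
- by move=> w /= /negP; rewrite -ltNge => /ltW; rewrite root_sum_sample !mxE summxE.
Qed.

End block_statistics.

(** * Plugging in an independent estimator *)

Section plug_in.
Context (R : realType) (d d' : measure_display) (Omega : measurableType d)
  (X : measurableType d') (Pr : probability Omega R) (Xs : nat -> {RV Pr >-> X})
  (Q : probability X R) (k m : nat) (Theta : set 'cV[R]_k) (th0 : 'cV[R]_k).
Hypothesis iidX : iid Xs Q.
Hypothesis oTheta : open Theta.
Hypothesis Theta0 : Theta th0.

Variables (D : forall n, n.-tuple X -> 'cV[R]_k -> 'cV[R]_m)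
  (t : forall n, n.-tuple X -> 'cV[R]_k).
Arguments D : clear implicits.
Arguments t : clear implicits.

Hypothesis mD : forall n, coord_measurable ([set: n.-tuple X] `*` Theta)
  (fun z : n.-tuple X * 'cV[R]_k => D n z.1 z.2).
Hypothesis oD : forall th, local_seq Theta th0 th ->
  oP Pr (fun n w => D n (sample Xs 0 n w) (th n)).
Hypothesis mt : forall n, measurable_fun [set: n.-tuple X] (t n).

Lemma coord_measurable_section n th : Theta th ->
  coord_measurable [set: n.-tuple X] (fun x => D n x th).
Proof.
move=> Tth.
apply: (coord_measurable_comp (D := [set: n.-tuple X] `*` Theta)
  (f := fun z => D n z.1 z.2) (g := fun x => (x, th))).
- by apply: measurableX => //; exact: measurable_open.
- by move=> _ [x _ <-].
- by apply/measurable_fun_pair.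
- exact: mD.
Qed.

(* A sequence choosing a bad parameter whenever there is one is local. *)
Lemma prob_local_uniform (e dlt M : R) : 0 < e -> 0 < dlt ->
  \forall n \near \oo, forall th, Theta th ->
    enorm (Num.sqrt n%:R *: (th - th0)) <= M ->
    (Pr [set w | (e <= enorm (D n (sample Xs 0 n w) th))%R] <= dlt%:E)%E.
Proof.
move=> e0 dlt0.
pose bad n th := [/\ Theta th, enorm (Num.sqrt n%:R *: (th - th0)) <= M &
  ~ (Pr [set w | (e <= enorm (D n (sample Xs 0 n w) th))%R] <= dlt%:E)%E].
have [u uP] : {u : nat -> 'cV[R]_k & forall n,
    bad n (u n) \/ u n = th0 /\ forall th, ~ bad n th}.
  apply: (@choice _ _ (fun n v => bad n v \/ v = th0 /\ forall th, ~ bad n th)) => n.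
  have [[th bth]|nb] := pselect (exists th, bad n th); first by exists th; left.
  by exists th0; right; split=> // th bth; apply: nb; exists th.
have lu : local_seq Theta th0 u.
  split=> [n|]; first by case: (uP n) => [[]|[-> _]].
  (* [|M|] instead of [M]: where no parameter is bad the sequence sits at [th0], and the bound has
     to be nonnegative. *)
  exists `|M| => n; case: (uP n) => [[_ uM _]|[-> _]].
    exact: le_trans uM (ler_norm _).
  by rewrite subrr scaler0 (le_trans (enorm_le_norm _))// normr0 mulr0.
have mD' n : coord_measurable setT (fun w => D n (sample Xs 0 n w) (u n)).
  exact: (coord_measurable_sample (f := fun x => D n x (u n)) Xs 0
    (coord_measurable_section (lu.1 n))).
have := oP_enorm_ge mD' (oD lu) e0 dlt0.
apply: filterS => n Ple th Tth thM; apply: contrapT => nle.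
have : bad n th by split.
by case: (uP n) => [[_ _]//|[_ nb]] /nb.
Qed.

(** Here [t] sees one block and [D] the other, so consistency is asked for at the rate of the block
    of [D]. Half of [dlt] covers estimates that are too far from [th0] or outside [Theta]; the other
    half bounds the event [E] by integrating over its sections. *)
Lemma oP_plug_in (s1 l1 s2 l2 : nat -> nat) :
  l2 n @[n --> \oo] --> \oo ->
  (\forall n \near \oo, independent_rv Pr (sample Xs (s1 n) (l1 n))
                                          (sample Xs (s2 n) (l2 n))) ->
  OP Pr (fun n w => Num.sqrt (l2 n)%:R *:
                      (t (l1 n) (sample Xs (s1 n) (l1 n) w) - th0)) ->
  (forall dlt, 0 < dlt -> \forall n \near \oo,
    likely Pr dlt (fun w => Theta (t (l1 n) (sample Xs (s1 n) (l1 n) w)))) ->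
  oP Pr (fun n w => D (l2 n) (sample Xs (s2 n) (l2 n) w)
                      (t (l1 n) (sample Xs (s1 n) (l1 n) w))).
Proof.
move=> loo ind Ot Tt e dlt e0 dlt0.
have dlt2 : 0 < dlt / 2 by rewrite divr_gt0.
have dlt4 : 0 < dlt / 2 / 2 by rewrite divr_gt0.
have [M M0 tM] := Ot _ dlt4; have {}Tt := Tt _ dlt4.
(* Tightness is in the sup norm, the uniform bound in the Euclidean norm; [sqrt k] converts. *)
pose M' := Num.sqrt k%:R * M.
have unif : \forall n \near \oo, forall th, Theta th ->
    enorm (Num.sqrt (l2 n)%:R *: (th - th0)) <= M' ->
    (Pr [set w | (e <= enorm (D (l2 n) (sample Xs 0 (l2 n) w) th))%R] <=
      (dlt / 2)%:E)%E by exact: (loo _ (prob_local_uniform M' e0 dlt2)).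
near=> n.
have indn : independent_rv Pr (sample Xs (s1 n) (l1 n)) (sample Xs (s2 n) (l2 n)).
  by near: n.
have unifn : forall th, Theta th ->
    enorm (Num.sqrt (l2 n)%:R *: (th - th0)) <= M' ->
    (Pr [set w | (e <= enorm (D (l2 n) (sample Xs 0 (l2 n) w) th))%R] <=
      (dlt / 2)%:E)%E by near: n.
have H1 : likely Pr (dlt / 2 / 2) (fun w => `|Num.sqrt (l2 n)%:R *:
  (t (l1 n) (sample Xs (s1 n) (l1 n) w) - th0)| <= M) by near: n.
have H2 : likely Pr (dlt / 2 / 2) (fun w =>
  Theta (t (l1 n) (sample Xs (s1 n) (l1 n) w))) by near: n.
have H3 := likelyI H1 H2.
(* Intersecting with [F] leaves two kinds of sections: empty ones, and those at a parameter covered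
   by the uniform bound. It also confines [D] to parameters in [Theta], where it is measurable. *)
pose F := [set y : (l1 n).-tuple X | Theta (t (l1 n) y) /\
  enorm (Num.sqrt (l2 n)%:R *: (t (l1 n) y - th0)) <= M'].
have mTy : measurable [set y : (l1 n).-tuple X | Theta (t (l1 n) y)].
  by rewrite -[X in measurable X]setTI; apply: mt => //; exact: measurable_open.
have mF : measurable F.
  apply: measurableI => //; rewrite -[X in measurable X]setTI.
  apply: (@measurable_fun_le _ _ _ _ _ (cst M')) => //.
  apply: measurable_enorm; apply: coord_measurableZ; apply: coord_measurableB.
    by apply: measurable_fun_coord; exact: mt.
  exact: coord_measurable_cst.
pose E : set ((l1 n).-tuple X * (l2 n).-tuple X) :=
  (F `*` setT) `&` [set z | e <= enorm (D (l2 n) z.2 (t (l1 n) z.1))].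
have mE : measurable E.
  have mFT : measurable (F `*` [set: (l2 n).-tuple X]) by exact: measurableX.
  have mt1 : measurable_fun [set: (l1 n).-tuple X * (l2 n).-tuple X]
      (fun z => t (l1 n) z.1).
    refine (@measurableT_comp _ _ _ ((l1 n).-tuple X * (l2 n).-tuple X)%type
      ((l1 n).-tuple X) 'cV[R]_k (t (l1 n)) setT fst _ _); first exact: mt.
    exact: measurable_fst.
  apply: (@measurable_fun_le _ _ _ _ (cst e)) => //.
  apply: measurable_enorm.
  apply: (coord_measurable_comp (D := [set: (l2 n).-tuple X] `*` Theta)
    (f := fun z => D (l2 n) z.1 z.2) (g := fun z => (z.2, t (l1 n) z.1))).
  - by apply: measurableX => //; exact: measurable_open.
  - by move=> _ [z [[Tz _] _] <-].
  - by apply: measurable_funTS; exact: measurable_fun_pair.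
  - exact: mD.
have PE : likely Pr (dlt / 2) (fun w =>
    ~ E (sample Xs (s1 n) (l1 n) w, sample Xs (s2 n) (l2 n) w)).
  exists [set w | E (sample Xs (s1 n) (l1 n) w, sample Xs (s2 n) (l2 n) w)]; split => //.
    rewrite -[X in measurable X]setTI.
    have mp : measurable_fun setT (fun w =>
      (sample Xs (s1 n) (l1 n) w, sample Xs (s2 n) (l2 n) w)).
      by apply: measurable_fun_pair; exact: measurable_sample.
    exact: mp.
  apply: independent_pair_le => //.
  - exact: measurable_sample.
  - exact: measurable_sample.
  move=> y; have [[Ty yM]|nFy] := pselect (F y); last first.
    rewrite (_ : _ @^-1` _ = set0) ?measure0 ?lee_fin ?ltW//.
    by apply/seteqP; split=> // w; rewrite /xsection/= inE => -[[]].
  rewrite (_ : xsection E y =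
      [set x | e <= enorm (D (l2 n) x (t (l1 n) y))]); last first.
    apply/seteqP; split=> x; rewrite /xsection/= inE; first by case.
    by move=> ?; split.
  (* The uniform bound concerns the initial block; equality of laws moves it to the block starting
     at [s2 n]. *)
  rewrite (prob_sample_shift iidX _ 0%N); first exact: unifn.
  by apply: measurable_tuple_enorm_ge; exact: coord_measurable_section.
apply: likelyW (likelyI H3 PE) => w [[wM wT] nE].
apply: (le_trans (norm_le_enorm _)); rewrite leNgt; apply/negP => /ltW lt.
apply: nE; split=> //; split=> //; split=> //.
apply: (le_trans (enorm_le_norm _)).
by rewrite ler_wpM2l ?sqrtr_ge0.
Unshelve. all: by end_near. Qed.

(* Root-n consistency puts the estimator in the open set [Theta]. *)
Lemma likely_in_Theta (T : nat -> Omega -> 'cV[R]_k) (l : nat -> nat) :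
  l n @[n --> \oo] --> \oo ->
  OP Pr (fun n w => Num.sqrt (l n)%:R *: (T n w - th0)) ->
  forall dlt, 0 < dlt ->
    \forall n \near \oo, likely Pr dlt (fun w => Theta (T n w)).
Proof.
move=> loo OT dlt dlt0; have [M M0 TM] := OT _ dlt0.
have /nbhs_ballP[r r0 rT] : nbhs th0 Theta by exact: open_nbhs_nbhs.
(* On the event where the scaled error is at most [M], this leaves an error of at most [r / 2],
   inside the ball of radius [r]. *)
have big : \forall n \near \oo, 2 * M / r <= Num.sqrt (l n)%:R.
  exact: (loo _ (sqrt_infty _)).
near=> n.
have bign : 2 * M / r <= Num.sqrt (l n)%:R by near: n.
have : likely Pr dlt (fun w => `|Num.sqrt (l n)%:R *: (T n w - th0)| <= M) by near: n.
apply: likelyW => w wM; apply: rT.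
have q0 : 0 < 2 * M / r by rewrite divr_gt0// mulr_gt0.
have s0 : 0 < Num.sqrt (l n)%:R :> R by apply: lt_le_trans bign.
rewrite -ball_normE /= distrC -(ltr_pM2l s0) -{1}[Num.sqrt _]gtr0_norm// -normrZ.
apply: (le_lt_trans wM); apply: (@lt_le_trans _ _ (2 * M)); first lra.
by rewrite -ler_pdivrMr.
Unshelve. all: by end_near. Qed.

End plug_in.

(** * The split-sample estimator *)

Lemma sqrt_divn (R : realType) n :
  Num.sqrt n%:R * n%:R^-1 = (Num.sqrt n%:R)^-1 :> R.
Proof.
case: n => [|n]; first by rewrite sqrtr0 mul0r invr0.
rewrite -[X in _ * X^-1](@sqr_sqrtr R) ?ler0n//.
by field; rewrite gt_eqF// sqrtr_gt0 ltr0n.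
Qed.

(** A tolerance of 1/4 around 1/2 confines [lam n / n] to the interval from 1/4 to 3/4: each half
    keeps at least a quarter of the sample, and the absolute values become inert. *)
Lemma half_split_sizes (R : realType) (lam : nat -> int) :
  (lam n)%:~R / n%:R @[n --> \oo] --> (1 / 2 : R) ->
  \forall n \near \oo, [/\ `|lam n|%N%:Z = lam n, `|n%:Z - lam n|%N%:Z = n%:Z - lam n,
    (n <= 4 * `|lam n|)%N, (n <= 4 * `|n%:Z - lam n|)%N & (0 < n)%N].
Proof.
move=> /cvgrPdist_le/(_ (1 / 4)) H; near=> n.
have n0 : (0 < n)%N by near: n; exact: nbhs_infty_gt.
have n0' : 0 < n%:R :> R by rewrite ltr0n.
have : `|1 / 2 - (lam n)%:~R / n%:R| <= (1 / 4 : R) by near: n; apply: H; lra.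
rewrite ler_norml => /andP[h1 h2].
have lo : (n%:R : R) <= 4 * (lam n)%:~R.
  have : (1 / 4 : R) <= (lam n)%:~R / n%:R by lra.
  by rewrite ler_pdivlMr//; lra.
have hi : 4 * (lam n)%:~R <= (3 * n%:R : R).
  have : (lam n)%:~R / n%:R <= (3 / 4 : R) by lra.
  by rewrite ler_pdivrMr//; lra.
have lo' : (n%:Z <= 4 * lam n)%R.
  by rewrite -(@ler_int R) intrM.
have hi' : (4 * lam n <= 3 * n%:Z)%R.
  by rewrite -(@ler_int R) !intrM.
by split; lia.
Unshelve. all: by end_near. Qed.

(** Here [x], [y], [z] are the roots of the two block sizes and of [n]; [k1], [k2] the substituted
    statistics, [p] and [q] the normalized sums of [psi_kappa] and [psi_theta], [h] the estimation
    errors. Since [k1] is paired with [h2], the sum [q2] appears with coefficient [x ^+ 2 / (z * y)]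
    where [y / z] is wanted; the discrepancy [(x ^+ 2 - y ^+ 2) / (z * y)] vanishes in the limit for
    an even split. *)
Lemma split_identity (R : realType) m k (B : 'M[R]_(m, k)) (x y z : R)
    (k1 k2 k0 p1 p2 : 'cV[R]_m) (q1 q2 h1 h2 : 'cV[R]_k) :
  x != 0 -> y != 0 -> z != 0 -> x ^+ 2 + y ^+ 2 = z ^+ 2 ->
  z *: ((x ^+ 2 / z ^+ 2) *: k1 + (y ^+ 2 / z ^+ 2) *: k2 - k0) -
    z^-1 *: (x *: p1 + y *: p2) - B *m (z^-1 *: (x *: q1 + y *: q2)) =
  (x / z) *: (x *: (k1 - k0) - p1 - B *m (x *: h2)) +
  (y / z) *: (y *: (k2 - k0) - p2 - B *m (y *: h1)) +
  B *m ((x ^+ 2 / (z * y)) *: (y *: h2 - q2) + (y ^+ 2 / (z * x)) *: (x *: h1 - q1) +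
        (((x ^+ 2 - y ^+ 2) / (z * y)) *: q2 + ((y ^+ 2 - x ^+ 2) / (z * x)) *: q1)).
Proof.
move=> x0 y0 z0 xyz.
have {1}-> : k0 = (x ^+ 2 / z ^+ 2 + y ^+ 2 / z ^+ 2) *: k0.
  by rewrite -mulrDl xyz divff ?expf_neq0// scale1r.
rewrite !(mulmxDr, mulmxN, =^~ scalemxAr).
move: (B *m q1) (B *m q2) (B *m h1) (B *m h2) => v1 v2 v3 v4.
by apply/matrixP => i j; rewrite !mxE; field; rewrite x0 y0 z0.
Qed.

Lemma cvg_infty_of_le (l : nat -> nat) : (\forall n \near \oo, (n <= 4 * l n)%N) ->
  l n @[n --> \oo] --> \oo.
Proof.
move=> ln; apply/cvgnyPge => A; near=> n.
have H : (n <= 4 * l n)%N by near: n.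
have : (4 * A <= n)%N by near: n; exact: nbhs_infty_ge.
by move=> H'; have := leq_trans H' H; rewrite leq_pmul2l.
Unshelve. all: by end_near. Qed.

Lemma Psi_coord_measurable (R : realType) (d : measure_display)
    (X : measurableType d) k (Theta : set 'cV[R]_k) (P : 'cV[R]_k -> probability X R)
    m (psi : X -> 'cV[R]_k -> 'cV[R]_m) th :
  open Theta -> Psi Theta P m psi -> Theta th -> coord_measurable setT (psi^~ th).
Proof.
move=> oT [mpsi _] Tth.
apply: (coord_measurable_comp (D := [set: X] `*` Theta)
  (f := fun z => psi z.1 z.2) (g := fun x => (x, th))).
- by apply: measurableX => //; exact: measurable_open.
- by move=> _ [x _ <-].
- exact/measurable_fun_pair.
- exact: measurable_fun_coord.
Qed.

Lemma cvg_in_prob_enorm_oP (R : realType) (d : measure_display)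
    (Omega : measurableType d) (Pr : probability Omega R) m (a : nat -> R)
    (v : nat -> Omega -> 'cV[R]_m) :
  (forall n, coord_measurable setT (v n)) -> (forall n, 0 <= a n) ->
  cvg_in_prob Pr (fun n w => a n * enorm (v n w)) 0 ->
  oP Pr (fun n w => a n *: v n w).
Proof.
move=> mv a0; apply: cvg_in_prob_oP.
  by move=> n e; exact: measurable_enorm_geT.
near=> n => w; rewrite normrZ ger0_norm// ler_wpM2l//; exact: norm_le_enorm.
Unshelve. all: by end_near. Qed.

Section split_sample.
Context (R : realType) (d d' : measure_display)
    (X : measurableType d) (k m : nat)
    (Theta : set 'cV[R]_k) (P : 'cV[R]_k -> probability X R)
    (th0 : 'cV[R]_k)
    (Omega : measurableType d') (Pr : probability Omega R)
    (Xs : nat -> {RV Pr >-> X})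
    (kappa : 'cV[R]_k -> 'cV[R]_m)
    (psi_theta : X -> 'cV[R]_k -> 'cV[R]_k)
    (psi_kappa : X -> 'cV[R]_k -> 'cV[R]_m)
    (t : forall n, n.-tuple X -> 'cV[R]_k)
    (kn : forall n, n.-tuple X -> 'cV[R]_k -> 'cV[R]_m)
    (dflt1 dflt2 : forall n, n.-tuple X -> 'cV[R]_m)
    (c : 'cV[R]_k -> 'M[R]_(m, k))
    (lam : nat -> int).
Arguments t : clear implicits.
Arguments kn : clear implicits.
Arguments dflt1 : clear implicits.
Arguments dflt2 : clear implicits.
Hypothesis oTheta : open Theta.
Hypothesis Theta0 : Theta th0.
Hypothesis iidX : iid Xs (P th0).
Hypothesis C1kappa : C1_near kappa th0.
Hypothesis Psi_theta : Psi Theta P k psi_theta.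
Hypothesis Psi_kappa : Psi Theta P m psi_kappa.
Hypothesis mt : forall n, measurable_fun [set: n.-tuple X] (t n).
Hypothesis mkn : forall n, measurable_fun ([set: n.-tuple X] `*` Theta)
               (fun z : n.-tuple X * 'cV[R]_k => kn n z.1 z.2).
Hypothesis mdflt1 : forall n, measurable_fun [set: n.-tuple X] (dflt1 n).
Hypothesis mdflt2 : forall n, measurable_fun [set: n.-tuple X] (dflt2 n).
Hypothesis cc : {for th0, continuous c}.
Hypothesis ha : forall th, local_seq Theta th0 th ->
    cvg_in_prob Pr (fun n w => Num.sqrt n%:R *
      enorm (t n (sample Xs 0 n w) - th n
             - emp_mean Xs (psi_theta^~ (th n)) n w)) 0.
Hypothesis hb : forall th, local_seq Theta th0 th ->
    cvg_in_prob Pr (fun n w => Num.sqrt n%:R *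
      enorm (kn n (sample Xs 0 n w) (th n) - kappa (th n)
             - emp_mean Xs (psi_kappa^~ (th n)) n w)) 0.
Hypothesis hc : forall th, local_seq Theta th0 th ->
    cvg_in_prob Pr (fun n w =>
      enorm ((Num.sqrt n%:R)^-1 *: (\sum_(i < n) psi_kappa (Xs i w) (th n))
             - (Num.sqrt n%:R)^-1 *: (\sum_(i < n) psi_kappa (Xs i w) th0)
             - c th0 *m (Num.sqrt n%:R *: (th n - th0)))) 0.
Hypothesis hlam : (lam n)%:~R / n%:R @[n --> \oo] --> (1 / 2 : R).

Let B : 'M[R]_(m, k) := derivative_mx kappa th0 + c th0.

Let rn (n : nat) : R := Num.sqrt n%:R.

Let dkappa : differentiable kappa th0.
Proof. by have [] := nbhs_singleton C1kappa. Qed.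

(** * The hypotheses as [oP] statements *)

Lemma root_emp_mean p (f : X -> 'cV[R]_p) n w :
  rn n *: emp_mean Xs f n w = root_sum f (sample Xs 0 n w).
Proof. by rewrite root_sum_sample /emp_mean scalerA sqrt_divn. Qed.

Lemma coord_measurable_emp_mean p (f : X -> 'cV[R]_p) n : coord_measurable setT f ->
  coord_measurable setT (emp_mean Xs f n).
Proof.
move=> mf; apply: coord_measurableZ; apply: coord_measurable_sum => i.
by apply: (coord_measurable_comp (D := setT) (f := f) (g := Xs i)).
Qed.

Lemma coord_measurable_kn n th : Theta th -> coord_measurable setT (fun x => kn n x th).
Proof.
move=> Tth; apply: (coord_measurable_section (D := kn) oTheta _ Tth) => l.
by apply: measurable_fun_coord; exact: mkn.
Qed.

Lemma local_seq_norm th : local_seq Theta th0 th ->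
  exists M, forall n, `|rn n *: (th n - th0)| <= M.
Proof. by move=> [_ [M thM]]; exists M => n; apply: le_trans (thM n); exact: norm_le_enorm. Qed.

Lemma local_seq_cst : local_seq Theta th0 (fun=> th0).
Proof.
split=> //; exists 0 => n; rewrite subrr scaler0.
by rewrite (le_trans (enorm_le_norm _))// normr0 mulr0.
Qed.

Lemma oP_theta th : local_seq Theta th0 th ->
  oP Pr (fun n w => rn n *: (t n (sample Xs 0 n w) - th n) -
                    root_sum (psi_theta^~ (th n)) (sample Xs 0 n w)).
Proof.
move=> lth; apply: eq_oP (cvg_in_prob_enorm_oP _ _ (ha lth)).
- by near=> n => w; rewrite [in RHS]scalerBr -root_emp_mean.
- move=> n; apply: coord_measurableB; last first.
    apply: coord_measurable_emp_mean.
    by apply: (Psi_coord_measurable oTheta Psi_theta); exact: lth.1.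
  apply: coord_measurableB; last exact: coord_measurable_cst.
  apply: (coord_measurable_sample (f := t n) Xs 0); apply: measurable_fun_coord.
  exact: mt.
- by move=> n; exact: sqrtr_ge0.
Unshelve. all: by end_near. Qed.

Lemma oP_kappa th : local_seq Theta th0 th ->
  oP Pr (fun n w => rn n *: (kn n (sample Xs 0 n w) (th n) - kappa (th n)) -
                    root_sum (psi_kappa^~ (th n)) (sample Xs 0 n w)).
Proof.
move=> lth; apply: eq_oP (cvg_in_prob_enorm_oP _ _ (hb lth)).
- by near=> n => w; rewrite [in RHS]scalerBr -root_emp_mean.
- move=> n; apply: coord_measurableB; last first.
    apply: coord_measurable_emp_mean.
    by apply: (Psi_coord_measurable oTheta Psi_kappa); exact: lth.1.
  apply: coord_measurableB; last exact: coord_measurable_cst.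
  apply: (coord_measurable_sample (f := fun x => kn n x (th n)) Xs 0).
  by apply: coord_measurable_kn; exact: lth.1.
- by move=> n; exact: sqrtr_ge0.
Unshelve. all: by end_near. Qed.

Lemma oP_score th : local_seq Theta th0 th ->
  oP Pr (fun n w => root_sum (psi_kappa^~ (th n)) (sample Xs 0 n w) -
                    root_sum (psi_kappa^~ th0) (sample Xs 0 n w) -
                    c th0 *m (rn n *: (th n - th0))).
Proof.
move=> lth; pose v n w := root_sum (psi_kappa^~ (th n)) (sample Xs 0 n w) -
  root_sum (psi_kappa^~ th0) (sample Xs 0 n w) - c th0 *m (rn n *: (th n - th0)).
have mv n : coord_measurable setT (v n).
  apply: coord_measurableB; last exact: coord_measurable_cst.
  apply: coord_measurableB.
    apply: (coord_measurable_sample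
      (f := fun x => root_sum (psi_kappa^~ (th n)) x) Xs 0).
    apply: coord_measurable_root_sum.
    by apply: (Psi_coord_measurable oTheta Psi_kappa); exact: lth.1.
  apply: (coord_measurable_sample (f := fun x => root_sum (psi_kappa^~ th0) x) Xs 0).
  apply: coord_measurable_root_sum.
  exact: (Psi_coord_measurable oTheta Psi_kappa).
have := cvg_in_prob_enorm_oP (Pr := Pr) (a := fun=> 1) mv.
move=> /(_ (fun=> ler01)) H.
apply: eq_oP (H _); first by near=> n => w; rewrite scale1r.
suff -> : (fun n w => 1 * enorm (v n w)) = (fun (n : nat) (w : Omega) =>
    enorm ((Num.sqrt n%:R)^-1 *: (\sum_(i < n) psi_kappa (Xs i w) (th n))
           - (Num.sqrt n%:R)^-1 *: (\sum_(i < n) psi_kappa (Xs i w) th0)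
           - c th0 *m (Num.sqrt n%:R *: (th n - th0)))) by exact: hc.
by apply/funext => n; apply/funext => w; rewrite mul1r /v !root_sum_sample.
Unshelve. all: by end_near. Qed.

Lemma expansion_kappa th : local_seq Theta th0 th ->
  oP Pr (fun n w => rn n *: (kappa (th n) - kappa th0 -
                             derivative_mx kappa th0 *m (th n - th0))).
Proof.
move=> lth; have [M thM] := local_seq_norm lth.
apply: (oP_cvg0 Pr (differentiable_local_seq dkappa thM)).
by near=> n => w; rewrite normr_id.
Unshelve. all: by end_near. Qed.

(** * The remainder at an estimated parameter *)

Let D n (x : n.-tuple X) (th : 'cV[R]_k) : 'cV[R]_m :=
  rn n *: (kn n x th - kappa th0) - root_sum (psi_kappa^~ th0) x -
  B *m (rn n *: (th - th0)).

Lemma oP_D th : local_seq Theta th0 th ->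
  oP Pr (fun n w => D (sample Xs 0 n w) (th n)).
Proof.
move=> lth.
apply: eq_oP (oPD (oPD (oP_kappa lth) (oP_score lth)) (expansion_kappa lth)).
near=> n => w; rewrite /D /B mulmxDl -!scalemxAr.
move: (c th0 *m _) (derivative_mx _ _ *m _) => u v.
by apply/matrixP => i j; rewrite !mxE; ring.
Unshelve. all: by end_near. Qed.

Lemma coord_measurable_D n : coord_measurable ([set: n.-tuple X] `*` Theta)
  (fun z : n.-tuple X * 'cV[R]_k => D z.1 z.2).
Proof.
have mTT : measurable ([set: n.-tuple X] `*` Theta).
  by apply: measurableX => //; exact: measurable_open.
apply: coord_measurableB; last first.
  apply: coord_measurableM; apply: coord_measurableZ.
  apply: coord_measurableB; last exact: coord_measurable_cst.
  by apply: measurable_fun_coord; apply: measurable_funTS; exact: measurable_snd.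
apply: coord_measurableB.
  apply: coord_measurableZ; apply: coord_measurableB; last exact: coord_measurable_cst.
  by apply: measurable_fun_coord; exact: mkn.
apply: (coord_measurable_comp (D := setT) (g := fst)
  (f := fun x : n.-tuple X => root_sum (psi_kappa^~ th0) x)) => //.
  by apply: measurable_funTS; exact: measurable_fst.
apply: coord_measurable_root_sum.
exact: (Psi_coord_measurable oTheta Psi_kappa).
Qed.

(** Hypothesis (a) along the constant sequence [th0], carried to an arbitrary block by equality of
    laws. *)
Lemma oP_block_theta (s l : nat -> nat) : l n @[n --> \oo] --> \oo ->
  oP Pr (fun n w => rn (l n) *: (t (l n) (sample Xs (s n) (l n) w) - th0) -
                    root_sum (psi_theta^~ th0) (sample Xs (s n) (l n) w)).
Proof.
move=> loo; apply: (oP_sample_shift iidX (g := fun n (x : n.-tuple X) =>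
  rn n *: (t n x - th0) - root_sum (psi_theta^~ th0) x) s _ loo).
  move=> n; apply: coord_measurableB; last first.
    apply: coord_measurable_root_sum.
    exact: (Psi_coord_measurable oTheta Psi_theta).
  apply: coord_measurableZ; apply: coord_measurableB; last exact: coord_measurable_cst.
  by apply: measurable_fun_coord; exact: mt.
exact: oP_theta local_seq_cst.
Qed.

Lemma OP_block_root (s l : nat -> nat) : l n @[n --> \oo] --> \oo ->
  OP Pr (fun n w => root_sum (psi_theta^~ th0) (sample Xs (s n) (l n) w)).
Proof.
move=> loo; have [mpsi /(_ _ Theta0)[psi0 psi2]] := Psi_theta.
apply: (OP_root_sum iidX) => //.
exact: (Psi_coord_measurable oTheta Psi_theta).
Qed.

Lemma OP_block_theta (s l : nat -> nat) : l n @[n --> \oo] --> \oo ->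
  OP Pr (fun n w => rn (l n) *: (t (l n) (sample Xs (s n) (l n) w) - th0)).
Proof.
move=> loo; have := OPD (oP_OP (oP_block_theta s loo)) (OP_block_root s loo).
apply: (OP_le (C := 1)); near=> n => w.
by rewrite subrK mul1r.
Unshelve. all: by end_near. Qed.

(** The default [y] may depend on the whole sample without harming independence: it is discarded on
    the likely event that the estimate lies in [Theta], before the plug-in bound is used. The
    comparison of sizes converts the rate of the estimating block into that of the evaluating
    block. *)
Lemma oP_substitute_block (s1 l1 s2 l2 : nat -> nat) (y : nat -> Omega -> 'cV[R]_m) :
  l1 n @[n --> \oo] --> \oo -> l2 n @[n --> \oo] --> \oo ->
  (\forall n \near \oo, (l2 n <= 4 * l1 n)%N) ->
  (\forall n \near \oo, independent_rv Pr (sample Xs (s1 n) (l1 n))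
                                          (sample Xs (s2 n) (l2 n))) ->
  oP Pr (fun n w =>
    let th := t (l1 n) (sample Xs (s1 n) (l1 n) w) in
    rn (l2 n) *: (substitute Theta (kn (l2 n) (sample Xs (s2 n) (l2 n) w)) (y n w) th
                  - kappa th0) -
    root_sum (psi_kappa^~ th0) (sample Xs (s2 n) (l2 n) w) -
    B *m (rn (l2 n) *: (th - th0))).
Proof.
move=> l1oo l2oo l21 ind e dlt e0 dlt0.
have dlt2 : 0 < dlt / 2 by rewrite divr_gt0.
have O1 := OP_block_theta s1 l1oo.
have inT := likely_in_Theta oTheta Theta0 l1oo O1.
have O2 : OP Pr (fun n w => rn (l2 n) *: (t (l1 n) (sample Xs (s1 n) (l1 n) w) - th0)).
  apply: (OP_le (C := 2)) O1; apply: filterS l21 => n l21 w.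
  rewrite !normrZ mulrA ler_wpM2r// !ger0_norm ?sqrtr_ge0//.
  have {1}-> : 2 = Num.sqrt 4%:R :> R.
    by rewrite (_ : 4%:R = 2 ^+ 2) ?sqrtr_sqr ?ger0_norm//; ring.
  by rewrite -sqrtrM// ler_wsqrtr// -natrM ler_nat.
have oD := oP_plug_in iidX oTheta Theta0 coord_measurable_D oP_D mt l2oo ind O2 inT.
have := oD _ _ e0 dlt2; apply: filterS2 (inT _ dlt2) => n H1 H2.
apply: likelyW (likelyI H1 H2) => w [wT]; rewrite /substitute.
by rewrite mem_set.
Qed.

Lemma root_sum_split p (f : X -> 'cV[R]_p) a b w : (0 < a)%N -> (0 < b)%N ->
  root_sum f (sample Xs 0 (a + b) w) =
  (rn (a + b))^-1 *: (rn a *: root_sum f (sample Xs 0 a w) +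
                      rn b *: root_sum f (sample Xs a b w)).
Proof.
move=> a0 b0; rewrite !root_sum_sample big_split_ord /= !scalerA.
by rewrite !divff ?scale1r// /rn gt_eqF// sqrtr_gt0 ltr0n.
Qed.

(** * Adding the two halves at [th0] *)

Let l1 (n : nat) := `|lam n|%N.
Let l2 (n : nat) := `|n%:Z - lam n|%N.
Let T := split_estimator Xs Theta t kn dflt1 dflt2 lam.

Lemma split_roots : \forall n \near \oo,
  [/\ (0 < l1 n)%N, (0 < l2 n)%N & (l1 n + l2 n = n)%N] /\
  [/\ rn (l1 n) ^+ 2 + rn (l2 n) ^+ 2 = rn n ^+ 2, rn n <= 2 * rn (l1 n),
   rn n <= 2 * rn (l2 n), (lam n)%:~R / n%:R = rn (l1 n) ^+ 2 / rn n ^+ 2 &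
   (n%:Z - lam n)%:~R / n%:R = rn (l2 n) ^+ 2 / rn n ^+ 2].
Proof.
apply: filterS (half_split_sizes hlam) => n [e1 e2 n1 n2 n0].
have l12 : (l1 n + l2 n = n)%N by rewrite /l1 /l2; lia.
have r2 p : rn p ^+ 2 = p%:R by rewrite /rn sqr_sqrtr ?ler0n.
have le2 p : (n <= 4 * p)%N -> rn n <= 2 * rn p.
  move=> np; rewrite -(@ler_pXn2r _ 2) ?nnegrE ?mulr_ge0 ?sqrtr_ge0//.
  by rewrite exprMn !r2 -natrX -natrM ler_nat.
split; split; rewrite ?r2.
- by rewrite /l1; lia.
- by rewrite /l2; lia.
- exact: l12.
- by rewrite -natrD l12.
- exact: le2.
- exact: le2.
- by rewrite -{1}e1.
- by rewrite -{1}e2.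
Qed.

Lemma l1_infty : l1 n @[n --> \oo] --> \oo.
Proof. by apply: cvg_infty_of_le; apply: filterS (half_split_sizes hlam) => n []. Qed.

Lemma l2_infty : l2 n @[n --> \oo] --> \oo.
Proof. by apply: cvg_infty_of_le; apply: filterS (half_split_sizes hlam) => n []. Qed.

Lemma oP_mulmx p q (A : 'M[R]_(p, q)) (Y : nat -> Omega -> 'cV[R]_q) :
  oP Pr Y -> oP Pr (fun n w => A *m Y n w).
Proof.
apply: (oP_le (C := q%:R * `|A|)); near=> n => w; exact: norm_mulmx_le.
Unshelve. all: by end_near. Qed.

Lemma oP_split_th0 :
  oP Pr (fun n w => rn n *: (T n w - kappa th0) -
    root_sum (psi_kappa^~ th0) (sample Xs 0 n w) -
    B *m root_sum (psi_theta^~ th0) (sample Xs 0 n w)).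
Proof.
have loo1 := l1_infty; have loo2 := l2_infty.
have sizes := split_roots.
have le12 : \forall n \near \oo, (l1 n <= 4 * l2 n)%N.
  by apply: filterS (half_split_sizes hlam) => n []; rewrite /l1 /l2; lia.
have le21 : \forall n \near \oo, (l2 n <= 4 * l1 n)%N.
  by apply: filterS (half_split_sizes hlam) => n []; rewrite /l1 /l2; lia.
have ind12 : \forall n \near \oo,
    independent_rv Pr (sample Xs 0 (l1 n)) (sample Xs (l1 n) (l2 n)).
  by near=> n; apply: (independent_sample iidX).
have ind21 : \forall n \near \oo,
    independent_rv Pr (sample Xs (l1 n) (l2 n)) (sample Xs 0 (l1 n)).
  by apply: filterS ind12 => n; exact: independent_rv_sym.
(* In [D1] the parameter comes from the second half and the statistic from the first; [D2] is the
   reverse. *)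
have D1 := oP_substitute_block (s1 := l1) (s2 := fun=> 0%N)
  (fun n w => dflt1 n (sample Xs 0 n w)) loo2 loo1 le12 ind21.
have D2 := oP_substitute_block (s1 := fun=> 0%N) (s2 := l1)
  (fun n w => dflt2 n (sample Xs 0 n w)) loo1 loo2 le21 ind12.
have G1 := oP_block_theta (fun=> 0%N) loo1.
have G2 := oP_block_theta l1 loo2.
have W1 := OP_block_root (fun=> 0%N) loo1.
have W2 := OP_block_root l1 loo2.
have pos p : (0 < p)%N -> 0 < rn p by move=> p0; rewrite sqrtr_gt0 ltr0n.
have nz : \forall n \near \oo, [/\ 0 < rn (l1 n), 0 < rn (l2 n) & 0 < rn n].
  apply: filterS sizes => n [[p1 p2 p12] _]; split; apply: pos => //.
  by rewrite -p12 addn_gt0 p1.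
(* [|a n|] equals [2 * |x ^+ 2 - y ^+ 2| / z ^+ 2] for the roots [x], [y], [z] of the sizes. It
   dominates both discrepancy coefficients of [split_identity] and tends to 0 by the limit of
   [lam n / n]. *)
pose a n : R := 2 * (2 * ((lam n)%:~R / n%:R) - 1).
have a0 : a n @[n --> \oo] --> 0.
  rewrite (_ : 0 = 2 * (2 * (1 / 2) - 1)); last by field.
  apply: cvgM; first exact: cvg_cst.
  apply: cvgB; last exact: cvg_cst.
  by apply: cvgM => //; exact: cvg_cst.
have aE n : rn (l1 n) ^+ 2 + rn (l2 n) ^+ 2 = rn n ^+ 2 -> 0 < rn n ->
  (lam n)%:~R / n%:R = rn (l1 n) ^+ 2 / rn n ^+ 2 ->
  `|a n| = 2 * `|rn (l1 n) ^+ 2 - rn (l2 n) ^+ 2| / rn n ^+ 2.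
  move=> e12 z0 lE; rewrite /a lE.
  have -> : 2 * (rn (l1 n) ^+ 2 / rn n ^+ 2) - 1 =
      (rn (l1 n) ^+ 2 - rn (l2 n) ^+ 2) / rn n ^+ 2.
    have -> : rn (l2 n) ^+ 2 = rn n ^+ 2 - rn (l1 n) ^+ 2 by rewrite -e12 addrAC subrr add0r.
    by field; rewrite gt_eqF.
  by rewrite !normrM normfV normrX (gtr0_norm z0) ger0_norm// mulrA.
(* Everything rests on [u ^+ 2 <= z ^+ 2 <= 2 * (z * v)]. The roles of [u] and [v] stay free because
   each half needs the bounds once. *)
have coef (u v z : R) : 0 < u -> 0 < v -> 0 < z -> u ^+ 2 + v ^+ 2 = z ^+ 2 -> z <= 2 * v ->
  [/\ `|u / z| <= 1, `|u ^+ 2 / (z * v)| <= 2 &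
      `|(u ^+ 2 - v ^+ 2) / (z * v)| <= 2 * `|u ^+ 2 - v ^+ 2| / z ^+ 2].
  move=> u0 v0 z0 uvz zv.
  have uz : u ^+ 2 <= z ^+ 2 by rewrite -uvz lerDl sqr_ge0.
  have zz : z ^+ 2 <= 2 * (z * v) by rewrite expr2 mulrCA ler_pM2l.
  split.
  - rewrite gtr0_norm ?divr_gt0// ler_pdivrMr// mul1r.
    by rewrite -(@ler_pXn2r _ 2) ?nnegrE; [|by []|exact: ltW|exact: ltW].
  - rewrite gtr0_norm ?divr_gt0 ?mulr_gt0 ?exprn_gt0//.
    by rewrite ler_pdivrMr ?mulr_gt0// (le_trans uz).
  - rewrite normrM normfV (gtr0_norm (mulr_gt0 z0 v0)) [2 * _]mulrC -mulrA.
    rewrite ler_wpM2l// ler_pdivlMr ?exprn_gt0// mulrC ler_pdivrMr ?mulr_gt0//.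
(* The sequence given here is the right-hand side of [split_identity], in which every term is
   controlled separately. *)
apply: (@eq_oP _ _ _ _ _ (fun n w =>
  (rn (l1 n) / rn n) *: (rn (l1 n) *: (substitute Theta (kn (l1 n) (sample Xs 0 (l1 n) w))
      (dflt1 n (sample Xs 0 n w)) (t (l2 n) (sample Xs (l1 n) (l2 n) w)) - kappa th0) -
    root_sum (psi_kappa^~ th0) (sample Xs 0 (l1 n) w) -
    B *m (rn (l1 n) *: (t (l2 n) (sample Xs (l1 n) (l2 n) w) - th0))) +
  (rn (l2 n) / rn n) *: (rn (l2 n) *: (substitute Theta (kn (l2 n) (sample Xs (l1 n) (l2 n) w))
      (dflt2 n (sample Xs 0 n w)) (t (l1 n) (sample Xs 0 (l1 n) w)) - kappa th0) -
    root_sum (psi_kappa^~ th0) (sample Xs (l1 n) (l2 n) w) -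
    B *m (rn (l2 n) *: (t (l1 n) (sample Xs 0 (l1 n) w) - th0))) +
  B *m ((rn (l1 n) ^+ 2 / (rn n * rn (l2 n))) *:
          (rn (l2 n) *: (t (l2 n) (sample Xs (l1 n) (l2 n) w) - th0) -
           root_sum (psi_theta^~ th0) (sample Xs (l1 n) (l2 n) w)) +
        (rn (l2 n) ^+ 2 / (rn n * rn (l1 n))) *:
          (rn (l1 n) *: (t (l1 n) (sample Xs 0 (l1 n) w) - th0) -
           root_sum (psi_theta^~ th0) (sample Xs 0 (l1 n) w)) +
        (((rn (l1 n) ^+ 2 - rn (l2 n) ^+ 2) / (rn n * rn (l2 n))) *:
           root_sum (psi_theta^~ th0) (sample Xs (l1 n) (l2 n) w) +
         ((rn (l2 n) ^+ 2 - rn (l1 n) ^+ 2) / (rn n * rn (l1 n))) *: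
           root_sum (psi_theta^~ th0) (sample Xs 0 (l1 n) w))))).
  apply: filterS2 sizes nz => n [[p1 p2 p12] [e12 _ _ lE1 lE2]] [z1 z2 z0] w.
  rewrite -split_identity ?gt_eqF// /T /split_estimator lE1 lE2 -/(l1 n) -/(l2 n).
  have rE p (f : X -> 'cV[R]_p) : root_sum f (sample Xs 0 n w) =
      (rn n)^-1 *: (rn (l1 n) *: root_sum f (sample Xs 0 (l1 n) w) +
                    rn (l2 n) *: root_sum f (sample Xs (l1 n) (l2 n) w)).
    by have := root_sum_split f w p1 p2; rewrite p12.
  by rewrite !rE.
apply: oPD.
  apply: oPD.
    apply: (oP_le (C := 1)) D1.
    apply: filterS2 sizes nz => n [_ [e12 _ zle _ _]] [z1 z2 z0] w.
    by rewrite normrZ ler_wpM2r//; have [] := coef _ _ _ z1 z2 z0 e12 zle.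
  apply: (oP_le (C := 1)) D2.
  apply: filterS2 sizes nz => n [_ [e12 zle _ _ _]] [z1 z2 z0] w.
  rewrite addrC in e12.
  by rewrite normrZ ler_wpM2r//; have [] := coef _ _ _ z2 z1 z0 e12 zle.
(* The first two terms are bounded coefficients times [oP] errors of the estimators; the last two
   are vanishing coefficients times tight sums. *)
apply: oP_mulmx; apply: oPD; apply: oPD.
- apply: (oP_le (C := 2)) G2.
  apply: filterS2 sizes nz => n [_ [e12 _ zle _ _]] [z1 z2 z0] w.
  by rewrite normrZ ler_wpM2r//; have [] := coef _ _ _ z1 z2 z0 e12 zle.
- apply: (oP_le (C := 2)) G1.
  apply: filterS2 sizes nz => n [_ [e12 zle _ _ _]] [z1 z2 z0] w.
  rewrite addrC in e12.
  by rewrite normrZ ler_wpM2r//; have [] := coef _ _ _ z2 z1 z0 e12 zle.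
- apply: (oP_cvg0M a0) W2.
  apply: filterS2 sizes nz => n [_ [e12 _ zle lE _]] [z1 z2 z0] w.
  by rewrite normrZ ler_wpM2r// aE//; have [] := coef _ _ _ z1 z2 z0 e12 zle.
- apply: (oP_cvg0M a0) W1.
  apply: filterS2 sizes nz => n [_ [e12 zle _ lE _]] [z1 z2 z0] w.
  rewrite normrZ ler_wpM2r// aE// distrC.
  by rewrite addrC in e12; have [] := coef _ _ _ z2 z1 z0 e12 zle.
Unshelve. all: by end_near. Qed.

(** * From [th0] to local sequences *)

(** Hypothesis (a) along [th0] and along [th] involves the same estimator, which disappears in the
    difference. What remains is the analogue of (c) for [psi_theta], with minus the identity in
    place of [c th0]. *)
Lemma oP_root_theta th : local_seq Theta th0 th ->
  oP Pr (fun n w => root_sum (psi_theta^~ (th n)) (sample Xs 0 n w) -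
    root_sum (psi_theta^~ th0) (sample Xs 0 n w) + rn n *: (th n - th0)).
Proof.
move=> lth; apply: eq_oP (oPB (oP_theta local_seq_cst) (oP_theta lth)).
by near=> n => w; apply/matrixP => i j; rewrite !mxE; ring.
Unshelve. all: by end_near. Qed.

Lemma OP_root_theta th : local_seq Theta th0 th ->
  OP Pr (fun n w => root_sum (psi_theta^~ (th n)) (sample Xs 0 n w)).
Proof.
move=> lth; have [M thM] := local_seq_norm lth.
have O0 : OP Pr (fun n w => root_sum (psi_theta^~ th0) (sample Xs 0 n w)).
  exact: (OP_block_root (fun=> 0%N) (l := id) cvg_id).
have Oth : OP Pr (fun n (w : Omega) => - (rn n *: (th n - th0))).
  by apply: (OP_bounded Pr (M := M)); near=> n => w; rewrite normrN.
have := OPD (OPD (oP_OP (oP_root_theta lth)) O0) Oth.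
apply: (OP_le (C := 1)); near=> n => w; rewrite mul1r le_eqVlt; apply/orP; left.
by apply/eqP; congr `|_|; apply/matrixP => i j; rewrite !mxE; ring.
Unshelve. all: by end_near. Qed.

Let Bn (th : 'cV[R]_k) : 'M[R]_(m, k) := derivative_mx kappa th + c th.

Lemma oP_Bn th : local_seq Theta th0 th ->
  oP Pr (fun n w => (Bn (th n) - B) *m root_sum (psi_theta^~ (th n)) (sample Xs 0 n w)).
Proof.
move=> lth; have [M thM] := local_seq_norm lth.
have cth := local_seq_cvg thM.
have [_ cd] := nbhs_singleton C1kappa.
have cB : Bn (th n) @[n --> \oo] --> B.
  by apply: cvgD; [exact: (cvg_comp _ _ cth cd)|exact: (cvg_comp _ _ cth cc)].
(* The factor [k] is the price of the sup norm in [norm_mulmx_le]. *)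
have a0 : k%:R * `|Bn (th n) - B| @[n --> \oo] --> 0.
  rewrite -[X in _ --> X](mulr0 k%:R); apply: cvgM; first exact: cvg_cst.
  rewrite -[X in _ --> X](@normr0 _ 'M[R]_(m, k)) -(subrr B).
  by apply: cvg_norm; apply: cvgB => //; exact: cvg_cst.
apply: (oP_cvg0M a0) (OP_root_theta lth); near=> n => w.
by rewrite [`|k%:R * _|]ger0_norm ?mulr_ge0//; exact: norm_mulmx_le.
Unshelve. all: by end_near. Qed.

Let psi_split x th := psi_kappa x th + (derivative_mx kappa th + c th) *m psi_theta x th.

(** With [h] the scaled shift [rn n *: (th n - th0)], recentring the [psi_kappa] sum yields the
    drift [c th0 *m h], recentring [kappa] yields [derivative_mx kappa th0 *m h], and recentring the
    [psi_theta] sum yields [- B *m h]. By the choice of [B] they cancel. *)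
Lemma oP_split th : local_seq Theta th0 th ->
  oP Pr (fun n w => rn n *: (T n w - kappa (th n) - emp_mean Xs (psi_split^~ (th n)) n w)).
Proof.
move=> lth.
have o1 := oPB oP_split_th0 (oP_score lth).
have o2 := oPB o1 (expansion_kappa lth).
have o3 := oPB o2 (oP_mulmx B (oP_root_theta lth)).
apply: eq_oP (oPB o3 (oP_Bn lth)).
near=> n => w.
have sE : root_sum (psi_split^~ (th n)) (sample Xs 0 n w) =
    root_sum (psi_kappa^~ (th n)) (sample Xs 0 n w) +
    Bn (th n) *m root_sum (psi_theta^~ (th n)) (sample Xs 0 n w).
  by rewrite /root_sum -scalemxAr -scalerDr mulmx_sumr -big_split.
rewrite [in LHS]scalerBr root_emp_mean sE.
move: (root_sum (psi_theta^~ (th n)) _) (root_sum (psi_theta^~ th0) _) => v1 v2.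
move: (th n - th0) (Bn (th n)) => h b.
rewrite !(mulmxDr, mulmxN, mulmxBl, =^~ scalemxAr) /B !mulmxDl.
move: (b *m v1) (c th0 *m v1) (c th0 *m v2) (c th0 *m h) => u1 u2 u3 u4.
move: (derivative_mx _ _ *m v1) (derivative_mx _ _ *m v2) (derivative_mx _ _ *m h).
move=> u5 u6 u7.
by apply/matrixP => i j; rewrite !mxE; ring.
Unshelve. all: by end_near. Qed.

(** * Measurability of the estimator and conclusion *)

(** The case distinction is measurable because [Theta] is open, and on the branch that evaluates
    [kn] the pair of sample and estimate stays in the domain where [kn] is measurable. *)
Lemma coord_measurable_substitute a b s s' (y : Omega -> 'cV[R]_m) :
  coord_measurable setT y ->
  coord_measurable setT (fun w => substitute Theta (kn a (sample Xs s a w)) (y w)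
                                    (t b (sample Xs s' b w))).
Proof.
move=> my i j.
have mth : measurable_fun setT (fun w => t b (sample Xs s' b w)).
  refine (@measurableT_comp _ _ _ Omega (b.-tuple X) 'cV[R]_k (t b) setT
    (sample Xs s' b) _ _); first exact: mt.
  exact: measurable_sample.
have mT : measurable [set w | Theta (t b (sample Xs s' b w))].
  by rewrite -[X in measurable X]setTI; apply: mth => //; exact: measurable_open.
rewrite (_ : (fun w => _) = (fun w => if t b (sample Xs s' b w) \in Theta
  then kn a (sample Xs s a w) (t b (sample Xs s' b w)) i j else y w i j)); last first.
  by apply/funext => w; rewrite /substitute; case: ifP.
have E : (fun w => t b (sample Xs s' b w) \in Theta) @^-1` [set true] =
    [set w | Theta (t b (sample Xs s' b w))].
  by apply/seteqP; split=> w /= => [/set_mem|/mem_set].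
apply: measurable_fun_if => //.
- by apply: (measurable_fun_bool true); rewrite E setTI.
- rewrite E setTI; move: i j.
  apply: (coord_measurable_comp (D := [set: a.-tuple X] `*` Theta)
    (f := fun z => kn a z.1 z.2)
    (g := fun w => (sample Xs s a w, t b (sample Xs s' b w)))).
  + by apply: measurableX => //; exact: measurable_open.
  + by move=> _ [w Tw <-].
  + apply: measurable_funTS; apply: measurable_fun_pair => //.
    exact: measurable_sample.
  + by apply: measurable_fun_coord; exact: mkn.
- by apply: measurable_funTS; exact: my.
Qed.

(** [cvg_in_prob] speaks of probabilities of actual events, so leaving [oP] calls for measurability
    of the whole estimator, defaults included. The constant [sqrt m] compares the Euclidean norm
    with the sup norm. *)
Lemma split_estimator_loc_asymp_linear :
  loc_asymp_linear Xs Theta th0 T kappa psi_split.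
Proof.
move=> th lth.
have mT n : coord_measurable setT (T n).
  apply: coord_measurableD; apply: coord_measurableZ; apply: coord_measurable_substitute.
    apply: (coord_measurable_sample (f := dflt1 n) Xs 0).
    by apply: measurable_fun_coord; exact: mdflt1.
  apply: (coord_measurable_sample (f := dflt2 n) Xs 0).
  by apply: measurable_fun_coord; exact: mdflt2.
apply: (@oP_cvg_in_prob _ _ _ _ _ _ _ (Num.sqrt m%:R) _ _ (oP_split lth)).
  move=> n e; apply: measurable_enorm_geT; apply: coord_measurableB.
    by apply: coord_measurableB => //; exact: coord_measurable_cst.
  apply: coord_measurable_emp_mean; apply: coord_measurableD.
    by apply: (Psi_coord_measurable oTheta Psi_kappa); exact: lth.1.
  apply: coord_measurableM.
  by apply: (Psi_coord_measurable oTheta Psi_theta); exact: lth.1.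
near=> n => w; rewrite ger0_norm ?mulr_ge0 ?sqrtr_ge0//.
rewrite normrZ (ger0_norm (sqrtr_ge0 _)) mulrCA ler_wpM2l ?sqrtr_ge0//.
exact: enorm_le_norm.
Unshelve. all: by end_near. Qed.

End split_sample.

Theorem theorem2p1 (R : realType) (d d' : measure_display)
    (X : measurableType d) (k m : nat)
    (Theta : set 'cV[R]_k) (P : 'cV[R]_k -> probability X R)
    (th0 : 'cV[R]_k)
    (Omega : measurableType d') (Pr : probability Omega R)
    (Xs : nat -> {RV Pr >-> X})
    (kappa : 'cV[R]_k -> 'cV[R]_m)
    (psi_theta : X -> 'cV[R]_k -> 'cV[R]_k)
    (psi_kappa : X -> 'cV[R]_k -> 'cV[R]_m)
    (t : forall n, n.-tuple X -> 'cV[R]_k)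
    (kn : forall n, n.-tuple X -> 'cV[R]_k -> 'cV[R]_m)
    (dflt1 dflt2 : forall n, n.-tuple X -> 'cV[R]_m)
    (c : 'cV[R]_k -> 'M[R]_(m, k))
    (lam : nat -> int) :
  open Theta -> Theta th0 ->
  iid Xs (P th0) ->
  C1_near kappa th0 ->
  Psi Theta P k psi_theta ->
  Psi Theta P m psi_kappa ->
  (forall n, measurable_fun [set: n.-tuple X] (t n)) ->
  (forall n, measurable_fun ([set: n.-tuple X] `*` Theta)
               (fun z : n.-tuple X * 'cV[R]_k => kn n z.1 z.2)) ->
  (forall n, measurable_fun [set: n.-tuple X] (dflt1 n)) ->
  (forall n, measurable_fun [set: n.-tuple X] (dflt2 n)) ->
  {for th0, continuous c} ->
  (forall th, local_seq Theta th0 th ->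
    cvg_in_prob Pr (fun n w => Num.sqrt n%:R *
      enorm (t n (sample Xs 0 n w) - th n
             - emp_mean Xs (psi_theta^~ (th n)) n w)) 0) ->
  (forall th, local_seq Theta th0 th ->
    cvg_in_prob Pr (fun n w => Num.sqrt n%:R *
      enorm (kn n (sample Xs 0 n w) (th n) - kappa (th n)
             - emp_mean Xs (psi_kappa^~ (th n)) n w)) 0) ->
  (forall th, local_seq Theta th0 th ->
    cvg_in_prob Pr (fun n w =>
      enorm ((Num.sqrt n%:R)^-1 *: (\sum_(i < n) psi_kappa (Xs i w) (th n))
             - (Num.sqrt n%:R)^-1 *: (\sum_(i < n) psi_kappa (Xs i w) th0)
             - c th0 *m (Num.sqrt n%:R *: (th n - th0)))) 0) ->
  (lam n)%:~R / n%:R @[n --> \oo] --> (1 / 2 : R) ->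
  loc_asymp_linear Xs Theta th0
    (split_estimator Xs Theta t kn dflt1 dflt2 lam) kappa
    (fun x th => psi_kappa x th
                 + (derivative_mx kappa th + c th) *m psi_theta x th).
Proof.
move=> oTheta Theta0 iidX C1kappa Psi_theta Psi_kappa mt mkn md1 md2 cc ha hb hc hlam.
exact: (split_estimator_loc_asymp_linear (P := P)).
Qed.
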